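(* Let $\Omega=[a,b]^\nu\subset\mathbb{R}^\nu$ and let $T_1$ be the partial integral operator on $\mathcal{H}=L_2(\Omega\times\Omega)$ with continuous kernel $k\in C(\Omega^3)$, i.e. $(T_1f)(x,y)=\int_\Omega k(x,s,y)f(s,y)\,ds$. A number $\lambda\in\mathbb{C}$, $\lambda\neq 0$, is an eigenvalue of $T_1$ if and only if $\lambda^{-1}\in\mathcal{X}_{T_1}$, where $\mathcal{X}_{T_1}$ is the set of characteristic numbers of the partial integral equation $f-\varkappa T_1f=g_0$.
   Context: Here $a<b$ are reals, $\nu\ge 1$ is an integer, $\mu$ is Lebesgue measure on $\Omega=[a,b]^\nu$, $\mathcal{H}=L_2(\Omega\times\Omega)$ and $\mathcal{H}_0=L_2(\Omega)$ are complex Hilbert spaces. For $k\in C(\Omega^3)$ (complex-valued), $T_1$ is the bounded operator on $\mathcal{H}$ given by $(T_1f)(x,y)=\int_\Omega k(x,s,y)f(s,y)\,ds$. For $\alpha\in\Omega$, $K_\alpha$ is the compact integral operator on $\mathcal{H}_0$ with kernel $k(x,s,\alpha)$: $(K_\alpha\varphi)(x)=\int_\Omega k(x,s,\alpha)\varphi(s)\,ds$. Determinant: for $\varkappa\in\mathbb{C}$ and $y\in\Omega$, $D_1(y;\varkappa)$ denotes the Fredholm determinant of $E-\varkappa K_y$ ($E$ the identity on $\mathcal{H}_0$), i.e. $$D_1(y;\varkappa)=1+\sum_{n=1}^\infty\frac{(-\varkappa)^n}{n!}\int_{\Omega^n}\det\big(k(\xi_i,\xi_j,y)\big)_{i,j=1}^n\,d\xi_1\cdots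 d\xi_n .$$ It is a continuous function of $y\in\Omega$ for each $\varkappa$. A number $\varkappa_0\in\mathbb{C}$ is a characteristic number of the equation $f-\varkappa T_1f=g_0$ if there is a measurable subset $\Omega_0\subset\Omega$ with $\mu(\Omega_0)>0$ such that $D_1(y;\varkappa_0)=0$ for all $y\in\Omega_0$. The set of all characteristic numbers is $\mathcal{X}_{T_1}$. *)

(* Defs.v *)
From HB Require Import structures.
From mathcomp Require Import all_boot all_order all_algebra.
From mathcomp Require Import complex.
From mathcomp Require Import all_classical all_reals all_analysis.

Set Implicit Arguments.
Unset Strict Implicit.
Unset Printing Implicit Defensive.
Import Order.TTheory GRing.Theory Num.Theory.
Import numFieldNormedType.Exports.

Local Open Scope classical_set_scope.
Local Open Scope ring_scope.

(* The canonical sigma-finite structure that unification finds on [m1 \x m2]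
   requires subprobabilities, hence this explicit lemma. *)
Lemma sigma_finite_prod d1 d2 (T1 : measurableType d1) (T2 : measurableType d2)
    (R : realType) (m1 : {sigma_finite_measure set T1 -> \bar R})
    (m2 : {sigma_finite_measure set T2 -> \bar R}) :
  sigma_finite setT (m1 \x m2)%E.
Proof.
have /sigma_finiteP[F [TF ndF Foo]] := sigma_finiteT m1.
have /sigma_finiteP[G [TG ndG Goo]] := sigma_finiteT m2.
exists (fun n => F n `*` G n).
  rewrite -setXTT TF TG predeqE => -[x y]; split.
    move=> [/= [n _ Fnx] [k _ Gky]]; exists (maxn n k) => //; split.
    - by move: x Fnx; exact/subsetPset/ndF/leq_maxl.
    - by move: y Gky; exact/subsetPset/ndG/leq_maxr.
  by move=> [n _ []/= ? ?]; split; exists n.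
move=> k; have [? ?] := Foo k; have [? ?] := Goo k.
split; first exact: measurableX.
by rewrite product_measure1E// lte_mul_pinfty// ge0_fin_numE.
Qed.

(* [pushforward] of a sigma-finite measure along a measurable map with a
   measurable left inverse, packaged as a sigma-finite measure. *)
Section sigma_finite_pushforward.
Context d1 d2 (T1 : measurableType d1) (T2 : measurableType d2) (R : realType).
Variable m : {measure set T1 -> \bar R}.
Variables (f : T1 -> T2) (g : T2 -> T1).
Hypotheses (mf : measurable_fun setT f) (mg : measurable_fun setT g).
Hypotheses (fK : cancel f g) (sfm : sigma_finite setT m).

Let push := pushforward m f.

Let push0 : push set0 = 0%E.
Proof. by rewrite /push /pushforward preimage_set0 measure0. Qed.

Let push_ge0 A : (0 <= push A)%E. Proof. exact: measure_ge0. Qed.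

Let push_sigma_additive : semi_sigma_additive push.
Proof.
move=> F mF tF mUF; rewrite /push /pushforward preimage_bigcup.
apply: measure_semi_sigma_additive.
- by move=> n; rewrite -[X in measurable X]setTI; exact: mf.
- apply/trivIsetP => /= i j _ _ ij; rewrite -preimage_setI.
  by move/trivIsetP : tF => /(_ _ _ _ _ ij) ->//; rewrite preimage_set0.
- by rewrite -preimage_bigcup -[X in measurable X]setTI; exact: mf.
Qed.

HB.instance Definition _ := isMeasure.Build _ _ _ push
  push0 push_ge0 push_sigma_additive.

Let push_sigma_finite : sigma_finite setT push.
Proof.
have [F FT Foo] := sfm.
exists (fun i => g @^-1` F i).
  by rewrite -preimage_bigcup -FT preimage_setT.
move=> i; have [mF Fi] := Foo i; split.
  by rewrite -[X in measurable X]setTI; exact: mg.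
rewrite /push /pushforward -comp_preimage (_ : g \o f = id)//.
by apply/funext => x /=; rewrite fK.
Qed.

HB.instance Definition _ := Measure_isSigmaFinite.Build _ _ _ push
  push_sigma_finite.

Definition sigma_finite_pushforward :
  {sigma_finite_measure set T2 -> \bar R} := push.

End sigma_finite_pushforward.

Section power_measure.
Context d (T : measurableType d) (R : realType).
Variable mu : {sigma_finite_measure set T -> \bar R}.

Let tuple_cons n (p : T * n.-tuple T) : n.+1.-tuple T :=
  [tuple of p.1 :: p.2].

Let tuple_uncons n (t : n.+1.-tuple T) : T * n.-tuple T :=
  (tnth t ord0, [tuple of behead t]).

Let measurable_tuple_cons n : measurable_fun setT (@tuple_cons n).
Proof. exact: measurable_cons. Qed.

Let measurable_tuple_uncons n : measurable_fun setT (@tuple_uncons n).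
Proof.
apply/measurable_fun_pairP; split; first exact: measurable_tnth.
exact: measurable_behead.
Qed.

Let tuple_consK n : cancel (@tuple_cons n) (@tuple_uncons n).
Proof. by case=> x t; congr pair; exact/val_inj. Qed.

(* The product measure [mu \x ... \x mu] ([n] factors) on [n.-tuple T]. *)
Fixpoint power_measure n : {sigma_finite_measure set (n.-tuple T) -> \bar R} :=
  match n with
  | 0 => \d_[tuple]
  | n.+1 => sigma_finite_pushforward
      (@measurable_tuple_cons n) (@measurable_tuple_uncons n) (@tuple_consK n)
      (sigma_finite_prod mu (power_measure n))
  end.

End power_measure.

Lemma power_measure_box d (T : measurableType d) (R : realType)
    (mu : {sigma_finite_measure set T -> \bar R}) n (A : 'I_n -> set T) :
  (forall i, measurable (A i)) ->
  (power_measure mu n [set t | forall i, A i (tnth t i)] =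
    \prod_(i < n) mu (A i))%E.
Proof.
elim: n A => [|n IHn] A mA.
  by rewrite big_ord0 /= diracE (_ : _ \in _)//; apply/mem_set => -[].
rewrite big_ord_recl -IHn// -product_measure1E//; last first.
  rewrite (_ : mkset _ = \bigcap_(i in [set: 'I_n])
      ((fun t => tnth t i) @^-1` A (lift ord0 i))); last first.
    by apply/seteqP; split => [t At i _|t At i]; exact: At.
  apply: fin_bigcap_measurable; first exact: finite_finset.
  by move=> i _; rewrite -[X in measurable X]setTI; exact: measurable_tnth.
rewrite /= /sigma_finite_pushforward /pushforward /=; congr product_measure1.
apply/seteqP; split => [[x t] /= At|[x t] /= [Ax At] i].
  by split=> [|i]; [exact: (At ord0)|have := At (lift ord0 i); rewrite tnthS].
by case: (unliftP ord0 i) => [j ->|->]; rewrite ?tnthS// tnth0.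
Qed.

(* 'rV[R]_n carries the sigma-algebra generated by the coordinates, i.e. the
   Borel sigma-algebra. *)
Section measurable_rV.
Variables (R : realType) (n : nat).

Let coord (i : 'I_n) (v : 'rV[R]_n) : R := v ord0 i.

Let rV_set0 : g_sigma_preimage coord set0.
Proof. exact: sigma_algebra0. Qed.

Let rV_setC A : g_sigma_preimage coord A -> g_sigma_preimage coord (~` A).
Proof. exact: sigma_algebraC. Qed.

Let rV_bigcup (F : _^nat) : (forall i, g_sigma_preimage coord (F i)) ->
  g_sigma_preimage coord (\bigcup_i (F i)).
Proof. exact: sigma_algebra_bigcup. Qed.

HB.instance Definition _ := @isMeasurable.Build default_measure_display
  'rV[R]_n (g_sigma_preimage coord) rV_set0 rV_setC rV_bigcup.

Lemma measurable_coord (i : 'I_n) :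
  measurable_fun [set: 'rV[R]_n] (fun v => v ord0 i).
Proof.
move=> _ Y mY; rewrite setTI; apply: sub_sigma_algebra => /=.
rewrite -bigcup_seq/=; exists i => /=; first by rewrite mem_index_enum.
by exists Y => //; rewrite setTI.
Qed.

Lemma measurable_fun_coordP d (T : measurableType d) (f : T -> 'rV[R]_n) :
  (forall i, measurable_fun [set: T] (fun t => f t ord0 i)) ->
  measurable_fun [set: T] f.
Proof.
move=> mf.
have : g_sigma_preimage (fun i => coord i \o f) `<=` measurable.
  apply: smallest_sub; first exact: sigma_algebra_measurable.
  rewrite -bigcup_seq => A [i _ [B mB <-]].
  exact: mf.
rewrite g_sigma_preimage_comp => h _ A mA.
by apply: h; exists A.
Qed.

End measurable_rV.

Section lebesgue_rV.
Variables (R : realType) (n : nat).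

Let row_of_tuple (t : n.-tuple (measurableTypeR R)) : 'rV[R]_n :=
  \row_i tnth t i.

Let tuple_of_row (v : 'rV[R]_n) : n.-tuple (measurableTypeR R) :=
  [tuple v ord0 i | i < n].

Let measurable_row_of_tuple : measurable_fun setT row_of_tuple.
Proof.
apply: measurable_fun_coordP => i.
rewrite [X in measurable_fun _ X](_ : _ = (fun t => tnth t i)); last first.
  by apply/funext => t; rewrite mxE.
exact: (@measurable_tnth _ (measurableTypeR R)).
Qed.

Let measurable_tuple_of_row : measurable_fun setT tuple_of_row.
Proof.
apply/measurable_fun_tnthP => i.
rewrite (_ : _ \o _ = (fun v : 'rV[R]_n => v ord0 i)); last first.
  by apply/funext => v /=; rewrite tnth_mktuple.
exact: measurable_coord.
Qed.

Let row_of_tupleK : cancel row_of_tuple tuple_of_row.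
Proof. by move=> t; apply: eq_from_tnth => i; rewrite tnth_mktuple mxE. Qed.

Definition lebesgue_rV : {sigma_finite_measure set 'rV[R]_n -> \bar R} :=
  sigma_finite_pushforward measurable_row_of_tuple measurable_tuple_of_row
    row_of_tupleK
    (sigma_finiteT (power_measure (@lebesgue_measure R) n)).

End lebesgue_rV.
Arguments lebesgue_rV {R} n.

Lemma lebesgue_rV_box (R : realType) n (A : 'I_n -> set R) :
  (forall i, measurable (A i)) ->
  (lebesgue_rV n [set v | forall i, A i (v ord0 i)] =
    \prod_(i < n) lebesgue_measure (A i))%E.
Proof.
move=> mA; rewrite -(@power_measure_box _ (measurableTypeR R))//=.
rewrite /lebesgue_rV /sigma_finite_pushforward /= /pushforward.
congr (power_measure _ _ _); apply/seteqP.
by split => t At i; have := At i; rewrite mxE.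
Qed.

Section complex_integral.
Context d (T : measurableType d) (R : realType).
Implicit Types (D : set T) (f : T -> R[i]).
Local Open Scope complex_scope.

Definition Cintegral (mu : {measure set T -> \bar R}) D f : R[i] :=
  (\int[mu]_(x in D) complex.Re (f x))%R +i*
  (\int[mu]_(x in D) complex.Im (f x))%R.

(* Representatives: an element of L_2(D) is such an [f] up to equality almost
   everywhere in [D]. *)
Definition L2 (mu : {measure set T -> \bar R}) D f : Prop :=
  [/\ measurable_fun D (fun x => complex.Re (f x)),
      measurable_fun D (fun x => complex.Im (f x)) &
      (\int[mu]_(x in D) ((ComplexField.Normc.normc (f x)) ^+ 2)%:E < +oo)%E].

(* [A] acts on representatives; the eigenvector is a nonzero class. *)
Definition L2_eigenvalue (mu : {measure set T -> \bar R}) D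
    (A : (T -> R[i]) -> (T -> R[i])) (lambda : R[i]) : Prop :=
  exists f, [/\ L2 mu D f, ~ (f = cst 0 %[ae mu in D]) &
    A f = (fun x => lambda * f x) %[ae mu in D]].

End complex_integral.

(* The Fredholm determinant of [id - kappa K], for [K] the integral operator
   on L_2(D) with kernel [ker]. *)
Definition fredholm_det d (T : measurableType d) (R : realType)
    (mu : {sigma_finite_measure set T -> \bar R}) (D : set T)
    (ker : T -> T -> R[i]) (kappa : R[i]) : R[i] :=
  let u n : R[i]^o := (- kappa) ^+ n / n`!%:R *
    Cintegral (power_measure mu n) [set xi | forall i, D (tnth xi i)]
      (fun xi => \det (\matrix_(i < n, j < n) ker (tnth xi i) (tnth xi j))) in
  1 + lim (series (fun n => u n.+1) @ \oo).

Section partial_integral_operator.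
Variables (R : realType) (nu : nat) (a b : R).
Implicit Type k : 'rV[R]_nu -> 'rV[R]_nu -> 'rV[R]_nu -> R[i].

Definition cube : set 'rV[R]_nu := [set x | forall i, a <= x ord0 i <= b].

Definition partial_integral k (f : 'rV[R]_nu * 'rV[R]_nu -> R[i]) :
    'rV[R]_nu * 'rV[R]_nu -> R[i] :=
  fun p => Cintegral (lebesgue_rV nu) cube (fun s => k p.1 s p.2 * f (s, p.2)).

Definition D1 k (y : 'rV[R]_nu) (kappa : R[i]) : R[i] :=
  fredholm_det (lebesgue_rV nu) cube (fun x s => k x s y) kappa.

Definition characteristic_numbers k : set R[i] :=
  [set kappa | exists Omega0 : set 'rV[R]_nu,
    [/\ measurable Omega0, Omega0 `<=` cube, (0 < lebesgue_rV nu Omega0)%E &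
        forall y, Omega0 y -> D1 k y kappa = 0]].

End partial_integral_operator.
Arguments cube {R} nu a b.

(* Main.v *)
Require Import Defs.
From mathcomp Require Import all_boot all_order all_algebra.
From mathcomp Require Import complex spectral.
From mathcomp Require Import all_classical all_reals all_analysis.
From mathcomp Require Import measurable_realfun.
From mathcomp Require Import ring lra.

(** Let [I_n] be the integrals of the determinants [det (k (xi_i, xi_j))] and
    [c_n (x, t)] those of the determinants bordered by a row [x] and a column
    [t]. Laplace expansion along the border gives
    [c_n = I_n k - n K c_(n-1)], and [I_(n+1)] is the trace of [c_n]; Hadamard's
    inequality makes the series [D = sum (-kappa)^n / n! I_n] and
    [G = sum (-kappa)^n / n! c_n] entire in [kappa]. The [j]-th derivatives in
    [kappa] thus satisfy [G_j = D_j k + kappa K G_j + j K G_(j-1)] and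
    [D_(j+1) = - tr G_j].
    If [D (y) <> 0], then [G = D k + kappa G K] shows that [kappa K_y psi = psi]
    only for [psi = 0]; so the fibers of an eigenfunction of [T_1] vanish unless
    [D (y) = 0], and Fubini's theorem gives a set of such [y] of positive
    measure.
    Conversely let [D (y) = 0]. As [D] is not identically zero in [kappa], there
    is a least [r] such that [G_r] does not vanish almost everywhere; then
    [D_r = 0], hence [G_r = kappa K_y G_r]. One [r] works for a set [A] of [y]
    of positive measure, and for a suitable [t] the function
    [G_r (x, t; y) 1_A (y)] is an eigenfunction of [T_1]. *)

Set Implicit Arguments.
Unset Strict Implicit.
Unset Printing Implicit Defensive.
Import Order.TTheory GRing.Theory Num.Theory.
Import numFieldNormedType.Exports.
Local Open Scope classical_set_scope.
Local Open Scope ring_scope.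

Local Notation normc := ComplexField.Normc.normc.
Local Notation Re := complex.Re.
Local Notation Im := complex.Im.

(** * Hadamard inequality and entire generating series *)

(** Spectral theory of the compact operators [K_y] would give an eigenvector for each [y]
    separately, with no control of its dependence on [y]. The minors [G_r (x, t; y)] are explicit
    series, jointly measurable in all three variables, so an eigenfunction on the product arises
    without any measurable selection. The delicate point is that [tr G_j] is an integral over the
    diagonal, a null set: [G_j = 0] almost everywhere does not show that it vanishes. The recurrence
    is therefore inserted into the trace first, because [tr (K G_j)] is a double integral. This
    yields [D_(r+1) = 0] from [D_r = 0] and the vanishing of [G_j] for [j <= r]; if every [G_j]
    vanished, so would every derivative of [D] at [kappa], against [D = 1] at [0]. Continuity of [k]
    enters through the kernel cut off to the cube, which is bounded and measurable. All series
    converge at rate [2^-N], uniformly in the points, so uniqueness of sums, termwise integration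
    and the Taylor argument need only finite sums with explicit remainders. *)

Lemma hadamard (C : numClosedFieldType) n (A : 'M[C]_n) :
  `|\det A| ^+ 2 <= \prod_i \sum_j `|A i j| ^+ 2.
Proof.
set U := schmidt A; set V := map_mx Num.conj U^T.
have uU : U \is unitarymx by exact: schmidt_unitarymx.
have UV : U *m V = 1%:M by exact/unitarymxP.
have VU : V *m U = 1%:M by exact: mulmx1C.
(* Row [i] of [A] lies in the span of the Gram-Schmidt vectors of index at most [i], and these are
   orthogonal to row [j] of [U]. So multiplying by the unitary [V] makes [A] triangular. *)
have AV0 (i j : 'I_n) : (i < j)%N -> (A *m V) i j = 0.
  move=> ij.
  suff /sub_kermxP : (row i A <= kermx (col j V))%MS.
    move=> /matrixP/(_ 0 0); rewrite !mxE => h.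
    by rewrite -[RHS]h; apply: eq_bigr => l _; rewrite !mxE.
  apply: (submx_trans (row_schmidt_sub A i)).
  apply/sumsmx_subP => l li; rewrite genmxE; apply/sub_kermxP.
  apply/matrixP => x y; move/matrixP/(_ l j): UV; rewrite !mxE => h.
  rewrite -val_eqE (ltn_eqF (leq_ltn_trans li ij)) in h.
  by rewrite -[RHS]h; apply: eq_bigr => m _; rewrite !mxE.
have detV : `|\det V| = 1.
  have /(congr1 determinant) := UV.
  rewrite det_mulmx det1 /V det_map_mx det_tr => /(congr1 Num.norm).
  rewrite normrM norm_conjC normr1 -expr2 => /eqP.
  rewrite sqrf_eq1 => /orP[/eqP//|/eqP h].
  by have := normr_ge0 (\det U); rewrite h lerNr oppr0 ler10.
have trig : is_trig_mx (A *m V) by apply/is_trig_mxP.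
have -> : `|\det A| = `|\det (A *m V)| by rewrite det_mulmx normrM detV mulr1.
rewrite (det_trig trig) normr_prod -prodrXl.
apply: ler_prod => i _; rewrite exprn_ge0//=.
(* A unitary factor preserves the norm of each row, which in turn dominates the diagonal entry. *)
have -> : \sum_j `|A i j| ^+ 2 = \sum_j `|(A *m V) i j| ^+ 2.
  have sq m (B : 'M[C]_(n, m)) : \sum_j `|B i j| ^+ 2 = (B *m map_mx Num.conj B^T) i i.
    by rewrite mxE; apply: eq_bigr => j _; rewrite !mxE normCK.
  rewrite !sq trmx_mul map_mxM mulmxA -[A *m V *m _]mulmxA.
  have -> : map_mx Num.conj V^T = U by apply/matrixP => x y; rewrite !mxE conjCK.
  by rewrite VU mulmx1.
by rewrite (bigD1 i)//= lerDl sumr_ge0// => j _; rewrite exprn_ge0.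
Qed.

Lemma norm_normc (R : rcfType) (z : R[i]) : `|z| = (normc z)%:C%C.
Proof. by case: z. Qed.

Lemma normc_ge0 (R : rcfType) (z : R[i]) : 0 <= normc z.
Proof. by rewrite -ler0c -norm_normc. Qed.

Lemma normc_det_le (R : rcfType) n (A : 'M[R[i]]_n) (M : R) :
  (forall i j, normc (A i j) <= M) -> normc (\det A) ^+ 2 <= (n%:R * M ^+ 2) ^+ n.
Proof.
move=> AM; rewrite -lecR rmorphXn /= -norm_normc.
apply: (le_trans (hadamard A)); rewrite rmorphXn /= -[X in _ ^+ X]card_ord -prodr_const.
apply: ler_prod => i _; rewrite sumr_ge0/=; last by move=> j _; rewrite exprn_ge0.
rewrite mulr_natl -[X in _ *+ X]card_ord -sumr_const rmorph_sum/=.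
apply: ler_sum => j _; rewrite norm_normc -rmorphXn/= lecR ler_sqr ?nnegrE ?normc_ge0//.
exact: le_trans (normc_ge0 _) (AM i j).
Qed.

Lemma expr_div_fact_le (R : realType) (x : R) n : 0 <= x ->
  x ^+ n <= expR x * n`!%:R.
Proof.
move=> x0; rewrite -ler_pdivrMr ?ltr0n ?fact_gt0//.
case: n => [|n]; first by rewrite expr0 fact0 divr1; have := expR_ge1Dx x; lra.
by have := expR_ge1Dxn n x0; lra.
Qed.

(** This is [|M|^n n^(n/2)], which [n!] beats against every geometric factor. The bound [n! M^n]
    from the Leibniz formula would only give a finite radius of convergence. *)
Definition hadamard_bound (R : realType) (M : R) n : R :=
  Num.sqrt ((n%:R * M ^+ 2) ^+ n).

Lemma normc_det_hadamard (R : realType) n (A : 'M[R[i]]_n) (M : R) :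
  (forall i j, normc (A i j) <= M) -> normc (\det A) <= hadamard_bound M n.
Proof.
move=> /normc_det_le h; rewrite -(ger0_norm (normc_ge0 _)) -sqrtr_sqr.
by rewrite ler_wsqrtr.
Qed.

(* Coefficients of an everywhere convergent exponential generating series. *)
Definition entire (R : realType) (u : nat -> R) := forall rho : R, 0 <= rho ->
  exists C, forall n, `|u n| * rho ^+ n <= C * n`!%:R.

(** Squared, the claim is [n^n (M^2 rho^2)^n <= E n!^2]. One factor [n!] pays for [n^n <= e^n n!],
    the other for [(e M^2 rho^2)^n <= E n!]. *)
Lemma entire_hadamard (R : realType) (M : R) : entire (hadamard_bound M).
Proof.
move=> rho r0; pose E := expR (expR 1 * M ^+ 2 * rho ^+ 2) : R.
exists (Num.sqrt E) => n.
rewrite ger0_norm ?sqrtr_ge0// -[rho ^+ n]ger0_norm ?exprn_ge0// -sqrtr_sqr.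
rewrite -[n`!%:R]ger0_norm ?ler0n// -(sqrtr_sqr n`!%:R).
have hn : 0 <= (n%:R * M ^+ 2) ^+ n by rewrite exprn_ge0// mulr_ge0// sqr_ge0.
rewrite -!sqrtrM ?expR_ge0//.
rewrite ler_sqrt ?mulr_ge0 ?expR_ge0 ?sqr_ge0//.
have h1 : n%:R ^+ n <= expR 1 ^+ n * n`!%:R :> R.
  by rewrite -expRM_natr mul1r expr_div_fact_le.
have h2 := @expr_div_fact_le R (expR 1 * M ^+ 2 * rho ^+ 2) n _.
have {}h2 : (M ^+ 2 * rho ^+ 2) ^+ n * expR 1 ^+ n <= E * n`!%:R.
  rewrite -exprMn [M ^+ 2 * _ * _]mulrC mulrA; apply: h2.
  by rewrite -mulrA mulr_ge0 ?expR_ge0// mulr_ge0 ?sqr_ge0.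
have f0 : 0 <= n`!%:R :> R by [].
rewrite exprMn -[(rho ^+ n) ^+ 2]exprAC -mulrA -exprMn.
have p0 : 0 <= (M ^+ 2 * rho ^+ 2) ^+ n.
  by apply: exprn_ge0; apply: mulr_ge0; exact: sqr_ge0.
apply: le_trans (_ : expR 1 ^+ n * n`!%:R * (M ^+ 2 * rho ^+ 2) ^+ n <= _).
  exact: ler_wpM2r.
rewrite [n`!%:R ^+ 2]expr2 mulrA; apply: le_trans (ler_wpM2r f0 h2).
by rewrite mulrAC [X in X * n`!%:R <= _]mulrC.
Qed.

Lemma entire_le (R : realType) (u v : nat -> R) :
  (forall n, `|u n| <= `|v n|) -> entire v -> entire u.
Proof.
move=> uv ev rho r0; have [C hC] := ev rho r0; exists C => n.
by apply: le_trans (hC n); rewrite ler_wpM2r ?exprn_ge0.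
Qed.

Lemma entire_scale (R : realType) (u : nat -> R) (x y : R) :
  entire u -> entire (fun n => x * y ^+ n * u n).
Proof.
move=> eu rho r0.
have [C hC] := eu (`|y| * rho) (mulr_ge0 (normr_ge0 _) r0).
exists (`|x| * C) => n; rewrite -mulrA !normrM normrX.
have := ler_wpM2l (normr_ge0 x) (hC n); rewrite exprMn; lra.
Qed.

Lemma entire_shift (R : realType) (u : nat -> R) :
  entire u -> entire (fun n => u n.+1).
Proof.
move=> eu rho r0.
(* The factor [2] absorbs the [n.+1] that separates [n.+1!] from [n!]; with [rho + 1 >= 1] the
   exponent can be raised from [n] to [n.+1]. *)
have [C hC] := eu (2 * (rho + 1)) ltac:(lra); exists C => n.
have n2 : (n.+1)%:R <= 2 ^+ n.+1 :> R by rewrite -natrX ler_nat ltnW// ltn_expl.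
have := hC n.+1; rewrite exprMn factS natrM.
have p1 : 0 < 2 ^+ n.+1 :> R by exact: exprn_gt0.
have C0 : 0 <= C by have := hC 0; rewrite expr0 mulr1 fact0 mulr1; exact: le_trans.
have f0 : 0 <= n`!%:R :> R by [].
have rr : rho ^+ n <= (rho + 1) ^+ n.+1.
  apply: le_trans (_ : (rho + 1) ^+ n <= _); first by rewrite lerXn2r ?nnegrE//; lra.
  rewrite exprS ler_peMl ?exprn_ge0//; lra.
move=> h.
have h1 : C * (n.+1%:R * n`!%:R) <= 2 ^+ n.+1 * (C * n`!%:R).
  rewrite mulrCA; apply: ler_wpM2r => //; exact: mulr_ge0.
have h2 : `|u n.+1| * rho ^+ n <= `|u n.+1| * (rho + 1) ^+ n.+1 by exact: ler_wpM2l.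
apply: (le_trans h2); rewrite -(ler_pM2l p1); lra.
Qed.

Lemma entire_shiftn (R : realType) (u : nat -> R) j :
  entire u -> entire (fun n => u (n + j)%N).
Proof.
elim: j u => [|j IH] u eu; first by apply: entire_le eu => n; rewrite addn0.
apply: entire_le (IH _ (entire_shift eu)) => n; by rewrite addnS.
Qed.

(** * Bounded measurable functions *)

(** Both conditions are imposed on the whole type rather than on the domain of integration, so that
    sections, compositions and products stay in the class without side conditions. *)
Definition bounded_measurable d (T : measurableType d) (R : realType) (f : T -> R) :=
  measurable_fun setT f /\ exists M : R, forall x, `|f x| <= M.
Local Notation rbm := bounded_measurable.

Section rbm_theory.
Context d (T : measurableType d) (R : realType).
Implicit Types f g : T -> R.

Lemma rbm_cst (c : R) : rbm (fun _ : T => c).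
Proof. by split => //; exists `|c|. Qed.

Lemma rbmD f g : rbm f -> rbm g -> rbm (fun x => f x + g x).
Proof.
move=> [mf [M fM]] [mg [N gN]]; split; first exact: measurable_funD.
exists (M + N) => x; exact: le_trans (ler_normD _ _) (lerD _ _).
Qed.

Lemma rbmM f g : rbm f -> rbm g -> rbm (fun x => f x * g x).
Proof.
move=> [mf [M fM]] [mg [N gN]]; split; first exact: measurable_funM.
by exists (M * N) => x; rewrite normrM ler_pM.
Qed.

Lemma rbm_comp d' (T' : measurableType d') (h : T' -> T) f :
  measurable_fun setT h -> rbm f -> rbm (fun x => f (h x)).
Proof.
move=> mh [mf [M fM]]; split; first exact: measurableT_comp.
by exists M => x.
Qed.

Lemma rbm_indic (A : set T) : measurable A -> rbm (\1_A : T -> R).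
Proof.
move=> mA; split; first exact: measurable_indic.
by exists 1 => x; rewrite indicE; case: (_ \in _); rewrite ?normr1 ?normr0.
Qed.

Lemma rbm_integrable (mu : {measure set T -> \bar R}) D f :
  measurable D -> (mu D < +oo)%E -> rbm f -> mu.-integrable D (EFin \o f).
Proof.
move=> mD muD [mf [M fM]]; apply: measurable_bounded_integrable => //.
  exact: measurable_funTS.
exists M; split; first exact: num_real.
by move=> y My x _; exact: le_trans (fM x) (ltW My).
Qed.

Lemma normr_Rintegral_le (mu : {measure set T -> \bar R}) D f M :
  measurable D -> (mu D < +oo)%E -> measurable_fun setT f ->
  (forall x, `|f x| <= M) -> `|\int[mu]_(x in D) f x| <= M * fine (mu D).
Proof.
move=> mD muD mf fM; have bf : rbm f by split => //; exists M.
apply: le_trans (le_normr_Rintegral mD (rbm_integrable mD muD bf)) _.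
rewrite -Rintegral_cst//; apply: le_Rintegral => //.
  apply: rbm_integrable => //; split; first exact: measurableT_comp.
  by exists M => x; rewrite normr_id.
exact: (rbm_integrable mD muD (rbm_cst M)).
Qed.

End rbm_theory.

Lemma rbm_Rintegral d1 d2 (P : measurableType d1) (T : measurableType d2)
    (R : realType) (mu : {sigma_finite_measure set T -> \bar R}) D
    (f : P * T -> R) :
  measurable D -> (mu D < +oo)%E -> rbm f ->
  rbm (fun p => \int[mu]_(x in D) f (p, x)).
Proof.
move=> mD muD bf; case: (bf) => mf [M fM].
have bfp p : rbm (fun x => f (p, x)) by exact: rbm_comp bf.
split; last first.
  exists (M * fine (mu D)) => p; apply: normr_Rintegral_le => //.
  by case: (bfp p).
(* Adding [M] makes the integrand nonnegative, as Tonelli's theorem requires; the constant is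
   subtracted again after integration. *)
pose g (z : P * T) := ((f z + M) * \1_D z.2)%:E.
have mg : measurable_fun setT g.
  apply/measurable_EFinP; apply: measurable_funM.
    by apply: measurable_funD.
  exact: (measurableT_comp (measurable_indic mD) measurable_snd).
have g0 z : (0 <= g z)%E.
  rewrite lee_fin mulr_ge0//.
  by have := fM z; rewrite ler_norml; lra.
have -> : (fun p => \int[mu]_(x in D) f (p, x)) =
    (fun p => fine (fubini_F mu g p) - M * fine (mu D)).
  apply/funext => p; rewrite -Rintegral_cst//.
  have -> : fine (fubini_F mu g p) = \int[mu]_(x in D) (f (p, x) + M).
    rewrite Rintegral_mkcond /fubini_F; congr fine; apply: eq_integral => x _.
    by rewrite /g /= patchE indicE; case: (_ \in _); rewrite ?mulr1 ?mulr0.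
  rewrite RintegralD ?addrK//; first exact: rbm_integrable.
  exact: (rbm_integrable mD muD (rbm_cst T M)).
apply: measurable_funB => //.
apply: measurableT_comp => //.
exact: measurable_fun_fubini_tonelli_F.
Qed.

Section Rfubini.
Context d1 d2 (T1 : measurableType d1) (T2 : measurableType d2) (R : realType).
Variables (m1 : {sigma_finite_measure set T1 -> \bar R}).
Variables (m2 : {sigma_finite_measure set T2 -> \bar R}).
Variables (D1 : set T1) (D2 : set T2).
Hypotheses (mD1 : measurable D1) (mD2 : measurable D2).
Hypotheses (fD1 : (m1 D1 < +oo)%E) (fD2 : (m2 D2 < +oo)%E).
Variable f : T1 * T2 -> R.
Hypothesis bf : rbm f.

Let D := D1 `*` D2.
Let mD : measurable D. Proof. exact: measurableX. Qed.

Let fin : ((m1 \x m2) D < +oo)%E.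
Proof.
by rewrite product_measure1E// lte_mul_pinfty// ge0_fin_numE.
Qed.

Let intf : (m1 \x m2)%E.-integrable setT (EFin \o (f \_ D)).
Proof.
rewrite -restrict_EFin; apply/integrable_restrict => //; rewrite setTI.
exact: rbm_integrable.
Qed.

Lemma Rintegral_prod12 : \int[(m1 \x m2)%E]_(z in D) f z =
  \int[m1]_(x in D1) \int[m2]_(y in D2) f (x, y).
Proof.
rewrite Rintegral_mkcond {1}/Rintegral -(integral12_prod_meas1 intf).
rewrite [RHS]Rintegral_mkcond; congr fine; apply: eq_integral => x _.
rewrite /fubini_F /= [RHS]/= patchE.
have [xD|xD] := boolP (x \in D1).
  rewrite /Rintegral fineK; last first.
    apply: integrable_fin_num => //; apply: rbm_integrable => //.
    exact: rbm_comp bf.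
  rewrite [RHS]integral_mkcond; apply: eq_integral => y _.
  by rewrite /= !patchE in_setX xD /=; case: (y \in D2).
by apply: (@integral0_eq _ _ _ m2) => y _/=; rewrite patchE in_setX (negbTE xD).
Qed.

Lemma Rintegral_prod21 : \int[(m1 \x m2)%E]_(z in D) f z =
  \int[m2]_(y in D2) \int[m1]_(x in D1) f (x, y).
Proof.
rewrite Rintegral_mkcond {1}/Rintegral -(integral21_prod_meas1 intf).
rewrite [RHS]Rintegral_mkcond; congr fine; apply: eq_integral => x _.
rewrite /fubini_G /= [RHS]/= patchE.
have [xD|xD] := boolP (x \in D2).
  rewrite /Rintegral fineK; last first.
    apply: integrable_fin_num => //; apply: rbm_integrable => //.
    exact: (rbm_comp (h := fun y => (y, x))).
  rewrite [RHS]integral_mkcond; apply: eq_integral => y _.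
  by rewrite /= !patchE in_setX xD andbT /=; case: (y \in D1).
by apply: (@integral0_eq _ _ _ m1) => y _/=; rewrite patchE in_setX (negbTE xD) andbF.
Qed.

End Rfubini.

(** * Complex-valued bounded functions and their integrals *)

Definition cbm d (T : measurableType d) (R : realType) (f : T -> R[i]) :=
  bounded_measurable (fun x => Re (f x)) /\ bounded_measurable (fun x => Im (f x)).

Section normc_lemmas.
Variable R : realType.
Implicit Types x y z : R[i].

Lemma ReD x y : Re (x + y) = Re x + Re y. Proof. by case: x y => [a b] []. Qed.
Lemma ImD x y : Im (x + y) = Im x + Im y. Proof. by case: x y => [a b] []. Qed.
Lemma ReM x y : Re (x * y) = Re x * Re y - Im x * Im y.
Proof. by case: x y => [a b] []. Qed.
Lemma ImM x y : Im (x * y) = Re x * Im y + Im x * Re y.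
Proof. by case: x y => [a b] []. Qed.
Lemma ReN x : Re (- x) = - Re x. Proof. by case: x. Qed.
Lemma ImN x : Im (- x) = - Im x. Proof. by case: x. Qed.

Lemma complex_ext x y : Re x = Re y -> Im x = Im y -> x = y.
Proof. by case: x y => [a b] [c d] /= -> ->. Qed.

Lemma normr_Re_le z : `|Re z| <= normc z.
Proof. by have := normc_ge_Re z; rewrite norm_normc lecR. Qed.

Lemma normr_Im_le z : `|Im z| <= normc z.
Proof.
have := normr_Re_le (z * 'i%C); rewrite ReiNIm normrN.
by rewrite ComplexField.Normc.normcM /= expr0n expr1n add0r sqrtr1 mulr1.
Qed.

Lemma normc_le_ReIm z : normc z <= `|Re z| + `|Im z|.
Proof.
case: z => a b /=; rewrite -[leRHS]ger0_norm ?addr_ge0// -sqrtr_sqr ler_wsqrtr//.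
rewrite sqrrD !real_normK ?num_real// addrAC lerDl.
by rewrite mulrn_wge0 // mulr_ge0.
Qed.

Lemma normc_sum_le I (s : seq I) (P : pred I) (F : I -> R[i]) :
  normc (\sum_(i <- s | P i) F i) <= \sum_(i <- s | P i) normc (F i).
Proof.
elim/big_ind2: _ => //; first by rewrite ComplexField.Normc.normc0.
by move=> x1 x2 y1 y2 h1 h2; apply: le_trans (le_normcD _ _) (lerD h1 h2).
Qed.

Lemma normcX z n : normc (z ^+ n) = normc z ^+ n.
Proof.
elim: n => [|n IH]; first by rewrite !expr0 ComplexField.Normc.normc1.
by rewrite !exprS ComplexField.Normc.normcM IH.
Qed.

Lemma normc_nat n : normc (n%:R : R[i]) = n%:R.
Proof.
by rewrite normcMn ComplexField.Normc.normc1.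
Qed.

End normc_lemmas.

Section cbm_theory.
Context d (T : measurableType d) (R : realType).
Implicit Types f g : T -> R[i].

Lemma cbmP f : cbm f <-> [/\ measurable_fun setT (fun x => Re (f x)),
  measurable_fun setT (fun x => Im (f x)) & exists M, forall x, normc (f x) <= M].
Proof.
split=> [[[mR [M fM]] [mI [N fN]]]|[mR mI [M fM]]].
  split=> //; exists (M + N) => x.
  exact: le_trans (normc_le_ReIm _) (lerD _ _).
split; split=> //; exists M => x; apply: le_trans (fM x).
- exact: normr_Re_le.
- exact: normr_Im_le.
Qed.

Lemma cbm_cst (c : R[i]) : cbm (fun _ : T => c).
Proof. by split; exact: rbm_cst. Qed.

Lemma cbmD f g : cbm f -> cbm g -> cbm (fun x => f x + g x).
Proof.
move=> [? ?] [? ?]; split.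
- by under eq_fun do rewrite ReD; exact: rbmD.
- by under eq_fun do rewrite ImD; exact: rbmD.
Qed.

Lemma cbmM f g : cbm f -> cbm g -> cbm (fun x => f x * g x).
Proof.
move=> [? ?] [? ?]; split.
- under eq_fun do rewrite ReM -mulN1r; apply: rbmD; first exact: rbmM.
  by apply: rbmM (rbm_cst _ _) _; exact: rbmM.
- by under eq_fun do rewrite ImM; apply: rbmD; exact: rbmM.
Qed.

Lemma cbmZ c f : cbm f -> cbm (fun x => c * f x).
Proof. by move=> bf; apply: cbmM bf; exact: cbm_cst. Qed.

Lemma cbmN f : cbm f -> cbm (fun x => - f x).
Proof. by move=> bf; under eq_fun do rewrite -mulN1r; exact: cbmZ. Qed.

Lemma cbm_sum I (s : seq I) (P : pred I) (F : I -> T -> R[i]) :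
  (forall i, P i -> cbm (F i)) -> cbm (fun x => \sum_(i <- s | P i) F i x).
Proof.
move=> bF; elim: s => [|i s IH].
  by under eq_fun do rewrite big_nil; exact: cbm_cst.
under eq_fun do rewrite big_cons.
by have [Pi|//] := boolP (P i); apply: cbmD IH; exact: bF.
Qed.

Lemma cbm_prod I (s : seq I) (F : I -> T -> R[i]) :
  (forall i, cbm (F i)) -> cbm (fun x => \prod_(i <- s) F i x).
Proof.
move=> bF; elim: s => [|i s IH].
  by under eq_fun do rewrite big_nil; exact: cbm_cst.
by under eq_fun do rewrite big_cons; exact: cbmM.
Qed.

Lemma cbm_det n (F : T -> 'M[R[i]]_n) :
  (forall i j, cbm (fun x => F x i j)) -> cbm (fun x => \det (F x)).
Proof.
move=> bF; rewrite /determinant; apply: cbm_sum => s _; apply: cbmZ.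
by apply: cbm_prod => i.
Qed.

Lemma cbm_comp d' (T' : measurableType d') (h : T' -> T) f :
  measurable_fun setT h -> cbm f -> cbm (fun x => f (h x)).
Proof. by move=> mh [bR bI]; split; [exact: rbm_comp bR|exact: rbm_comp bI]. Qed.

Lemma cbm_indic (A : set T) : measurable A ->
  cbm (fun x => ((\1_A x)%:C)%C : R[i]).
Proof. by move=> mA; split; [exact: rbm_indic|exact: rbm_cst]. Qed.

End cbm_theory.

Section Cint.
Context d (T : measurableType d) (R : realType).
Variables (mu : {measure set T -> \bar R}) (D : set T).
Hypotheses (mD : measurable D) (fD : (mu D < +oo)%E).
Implicit Types f g : T -> R[i].

Lemma eq_Cint f g : (forall x, D x -> f x = g x) ->
  Cintegral mu D f = Cintegral mu D g.
Proof.
move=> fg; rewrite /Cintegral; congr (_ +i* _)%C; apply: eq_Rintegral => x;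
  by rewrite inE => /fg ->.
Qed.

Lemma CintD f g : cbm f -> cbm g ->
  Cintegral mu D (fun x => f x + g x) = Cintegral mu D f + Cintegral mu D g.
Proof.
move=> [? ?] [? ?]; rewrite /Cintegral; apply/complex_ext; rewrite !(ReD,ImD)/=.
- under eq_Rintegral do rewrite ReD.
  by rewrite RintegralD//; exact: rbm_integrable.
- under eq_Rintegral do rewrite ImD.
  by rewrite RintegralD//; exact: rbm_integrable.
Qed.

Lemma CintZ c f : cbm f ->
  Cintegral mu D (fun x => c * f x) = c * Cintegral mu D f.
Proof.
have intZ (r : R) (h : T -> R) : bounded_measurable h ->
    mu.-integrable D (EFin \o (fun x => r * h x)).
  move=> bh; apply: rbm_integrable => //; exact: rbmM (rbm_cst _ _) bh.
move=> [? ?]; rewrite /Cintegral; apply/complex_ext; rewrite !(ReM,ImM)/=.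
- under eq_Rintegral do rewrite ReM.
  rewrite RintegralB//; [|exact: intZ..].
  by rewrite !RintegralZl//; exact: rbm_integrable.
- under eq_Rintegral do rewrite ImM.
  rewrite RintegralD//; [|exact: intZ..].
  by rewrite !RintegralZl//; exact: rbm_integrable.
Qed.

Lemma Cint0 : Cintegral mu D (fun _ => 0 : R[i]) = 0.
Proof.
by have := @CintZ 0 _ (cbm_cst T 0); rewrite !mul0r.
Qed.

Lemma CintN f : cbm f -> Cintegral mu D (fun x => - f x) = - Cintegral mu D f.
Proof.
by move=> bf; rewrite -mulN1r -CintZ//; apply: eq_Cint => x _; rewrite mulN1r.
Qed.

Lemma Cint_sum I (s : seq I) (F : I -> T -> R[i]) : (forall i, cbm (F i)) ->
  Cintegral mu D (fun x => \sum_(i <- s) F i x) =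
  \sum_(i <- s) Cintegral mu D (F i).
Proof.
move=> bF; elim: s => [|i s IH].
  by rewrite big_nil -[RHS]Cint0; apply: eq_Cint => x _; rewrite big_nil.
rewrite big_cons -IH -CintD//; last exact: cbm_sum.
by apply: eq_Cint => x _; rewrite big_cons.
Qed.

(* The crude factor [2] comes from bounding real and imaginary parts separately. *)
Lemma normc_Cint_le f M : cbm f -> (forall x, normc (f x) <= M) ->
  normc (Cintegral mu D f) <= 2 * fine (mu D) * M.
Proof.
move=> [[mR _] [mI _]] fM; apply: le_trans (normc_le_ReIm _) _ => /=.
have hR : `|\int[mu]_(x in D) Re (f x)| <= M * fine (mu D).
  apply: normr_Rintegral_le => // x; exact: le_trans (normr_Re_le _) (fM x).
have hI : `|\int[mu]_(x in D) Im (f x)| <= M * fine (mu D).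
  apply: normr_Rintegral_le => // x; exact: le_trans (normr_Im_le _) (fM x).
lra.
Qed.

End Cint.

Lemma cbm_Cint d1 d2 (P : measurableType d1) (T : measurableType d2)
    (R : realType) (mu : {sigma_finite_measure set T -> \bar R}) D
    (f : P * T -> R[i]) :
  measurable D -> (mu D < +oo)%E -> cbm f ->
  cbm (fun p => Cintegral mu D (fun x => f (p, x))).
Proof.
move=> mD muD [bR bI]; split.
- exact: rbm_Rintegral mD muD bR.
- exact: rbm_Rintegral mD muD bI.
Qed.

Section Cfubini.
Context d1 d2 (T1 : measurableType d1) (T2 : measurableType d2) (R : realType).
Variables (m1 : {sigma_finite_measure set T1 -> \bar R}).
Variables (m2 : {sigma_finite_measure set T2 -> \bar R}).
Variables (D1 : set T1) (D2 : set T2).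
Hypotheses (mD1 : measurable D1) (mD2 : measurable D2).
Hypotheses (fD1 : (m1 D1 < +oo)%E) (fD2 : (m2 D2 < +oo)%E).
Variable f : T1 * T2 -> R[i].
Hypothesis bf : cbm f.

Lemma Cint_prod12 : Cintegral (m1 \x m2)%E (D1 `*` D2) f =
  Cintegral m1 D1 (fun x => Cintegral m2 D2 (fun y => f (x, y))).
Proof.
case: bf => bR bI; rewrite /Cintegral; congr (_ +i* _)%C.
- exact: Rintegral_prod12 bR.
- exact: Rintegral_prod12 bI.
Qed.

Lemma Cfubini :
  Cintegral m1 D1 (fun x => Cintegral m2 D2 (fun y => f (x, y))) =
  Cintegral m2 D2 (fun y => Cintegral m1 D1 (fun x => f (x, y))).
Proof.
rewrite -Cint_prod12; case: bf => bR bI; rewrite /Cintegral; congr (_ +i* _)%C.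
- exact: Rintegral_prod21 bR.
- exact: Rintegral_prod21 bI.
Qed.

End Cfubini.

(** * Iterated integrals and power measures *)

Section insert.
Context (T : Type).

Definition ins n (j : 'I_n.+1) (x : T) (g : 'I_n -> T) : 'I_n.+1 -> T :=
  fun i => oapp g x (unlift j i).

Lemma insK n (j : 'I_n.+1) x g i : ins j x g (lift j i) = g i.
Proof. by rewrite /ins liftK. Qed.

Lemma ins_id n (j : 'I_n.+1) x g : ins j x g j = x.
Proof. by rewrite /ins unlift_none. Qed.

Lemma ins_lift_ins0 n (j : 'I_n.+1) x y (g : 'I_n -> T) :
  ins (lift ord0 j) x (ins ord0 y g) = ins ord0 y (ins j x g).
Proof.
apply/funext => i; case: (unliftP ord0 i) => [i' ->|->]; last first.
  rewrite ins_id; have -> : ord0 = lift (lift ord0 j) (ord0 : 'I_n.+1).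
    by apply/val_inj.
  by rewrite insK ins_id.
rewrite insK; case: (unliftP j i') => [i'' ->|->]; last by rewrite !ins_id.
rewrite insK; have -> : lift ord0 (lift j i'') = lift (lift ord0 j) (lift ord0 i'').
  by apply/val_inj; rewrite /= /bump !add1n ltnS; case: (j <= i'')%N.
by rewrite !insK.
Qed.

Lemma insE n (j : 'I_n.+1) (g : 'I_n.+1 -> T) : ins j (g j) (g \o lift j) = g.
Proof.
apply/funext => i; case: (unliftP j i) => [i' ->|->]; first by rewrite insK.
by rewrite ins_id.
Qed.

Lemma tnth_cons n x (t : n.-tuple T) : tnth [tuple of x :: t] = ins ord0 x (tnth t).
Proof.
apply/funext => i; case: (unliftP ord0 i) => [i' ->|->].
  by rewrite insK tnthS.
by rewrite ins_id tnth0.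
Qed.

End insert.

Section iterated_integral.
Context d (T : measurableType d) (R : realType).
Variables (mu : {sigma_finite_measure set T -> \bar R}) (D : set T).
Hypotheses (mD : measurable D) (fD : (mu D < +oo)%E).
Let C := R[i].
Let Cint := Cintegral mu D.

(** Iterated integrals expose one variable at a time, which suits bordered determinants and Fubini
    exchanges; [Cintegral_power_measure] identifies them with the integrals in [fredholm_det]. *)
Fixpoint iterint n : (('I_n -> T) -> C) -> C :=
  match n with
  | 0 => fun F => F (tnth [tuple])
  | n.+1 => fun F => Cint (fun x => @iterint n (fun g => F (ins ord0 x g)))
  end.

Definition tbm n (F : ('I_n -> T) -> C) := cbm (fun t : n.-tuple T => F (tnth t)).

Lemma tbm_ins0 n (F : ('I_n.+1 -> T) -> C) : tbm F ->
  cbm (fun z : T * n.-tuple T => F (ins ord0 z.1 (tnth z.2))).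
Proof.
move=> bF; under eq_fun do rewrite -tnth_cons.
apply: (cbm_comp (h := fun z : T * n.-tuple T => [tuple of z.1 :: z.2]) _ bF).
exact: measurable_cons.
Qed.

Lemma tbm_ins0_section n (F : ('I_n.+1 -> T) -> C) x : tbm F ->
  tbm (fun g => F (ins ord0 x g)).
Proof.
move=> /tbm_ins0 bF.
exact: (cbm_comp (pair1_measurable x) bF).
Qed.

Lemma cbm_iterint d' (P : measurableType d') n (F : P -> ('I_n -> T) -> C) :
  cbm (fun z : P * n.-tuple T => F z.1 (tnth z.2)) ->
  cbm (fun p => iterint (F p)).
Proof.
elim: n d' P F => [|n IH] d' P F bF /=.
  exact: (cbm_comp (pair2_measurable [tuple]) bF).
apply: (@cbm_Cint _ _ P T R mu D (fun z => iterint (fun g => F z.1 (ins ord0 z.2 g)))) => //.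
apply: (IH _ _ (fun z g => F z.1 (ins ord0 z.2 g))).
under eq_fun do rewrite -tnth_cons.
apply: (cbm_comp (h := fun z : (P * T) * n.-tuple T => (z.1.1, [tuple of z.1.2 :: z.2])) _ bF).
apply/measurable_fun_pairP; split.
  exact: measurableT_comp measurable_fst measurable_fst.
by apply: measurable_cons => //; exact: measurableT_comp measurable_snd measurable_fst.
Qed.

Lemma cbm_iterint_ins0 n (F : ('I_n.+1 -> T) -> C) : tbm F ->
  cbm (fun x => iterint (fun g => F (ins ord0 x g))).
Proof.
move=> /tbm_ins0 bF.
exact: (@cbm_iterint _ T n (fun x g => F (ins ord0 x g))).
Qed.

Lemma iterintD n (F G : ('I_n -> T) -> C) : tbm F -> tbm G ->
  iterint (fun g => F g + G g) = iterint F + iterint G.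
Proof.
elim: n F G => [//|n IH] F G bF bG /=.
rewrite /Cint -CintD//; [|exact: cbm_iterint_ins0..].
by apply: eq_Cint => x _; apply: IH; exact: tbm_ins0_section.
Qed.

Lemma iterintZ n c (F : ('I_n -> T) -> C) : tbm F ->
  iterint (fun g => c * F g) = c * iterint F.
Proof.
elim: n F => [//|n IH] F bF /=.
rewrite /Cint -CintZ//; last exact: cbm_iterint_ins0.
by apply: eq_Cint => x _; apply: IH; exact: tbm_ins0_section.
Qed.

Lemma iterint_sum n I (s : seq I) (F : I -> ('I_n -> T) -> C) :
  (forall i, tbm (F i)) ->
  iterint (fun g => \sum_(i <- s) F i g) = \sum_(i <- s) iterint (F i).
Proof.
move=> bF; elim: s => [|i s IH].
  rewrite big_nil; have := @iterintZ n 0 (fun _ => 0) (cbm_cst _ _).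
  rewrite !mul0r => h; rewrite -[RHS]h; congr iterint.
  by apply/funext => g; rewrite big_nil.
rewrite big_cons -IH -iterintD//; last by apply: cbm_sum => l _; exact: bF.
by congr iterint; apply/funext => g; rewrite big_cons.
Qed.

Lemma normc_iterint_le n (F : ('I_n -> T) -> C) M : tbm F ->
  (forall g, normc (F g) <= M) ->
  normc (iterint F) <= (2 * fine (mu D)) ^+ n * M.
Proof.
elim: n F => [|n IH] F bF FM; first by rewrite expr0 mul1r; exact: FM.
rewrite [_ ^+ _.+1]exprS -mulrA; apply: normc_Cint_le => //; first exact: cbm_iterint_ins0.
by move=> x; apply: IH => //; exact: tbm_ins0_section.
Qed.

(** Variable [j] is moved outwards by induction, each step being one Fubini exchange with variable
    [0]. This is what will make all terms of a Laplace expansion integrate to the same value. *)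
Lemma iterint_ins n (j : 'I_n.+1) (F : ('I_n.+1 -> T) -> C) : tbm F ->
  iterint F = Cint (fun x => iterint (fun g => F (ins j x g))).
Proof.
elim: n j F => [|n IH] j F bF; first by rewrite (ord1 j).
case: (unliftP ord0 j) => [j' ->|->//].
rewrite [LHS]/=.
transitivity (Cint (fun y => Cint (fun x =>
    iterint (fun g => F (ins ord0 y (ins j' x g)))))).
  apply: eq_Cint => y _; apply: (IH j' (fun g => F (ins ord0 y g))).
  exact: tbm_ins0_section.
have bH : cbm (fun z : T * T => iterint (fun g => F (ins ord0 z.1 (ins j' z.2 g)))).
  apply: (@cbm_iterint _ (T * T)%type n (fun z g => F (ins ord0 z.1 (ins j' z.2 g)))).
  pose h (z : (T * T) * n.-tuple T) :=
    [tuple ins ord0 z.1.1 (ins j' z.1.2 (tnth z.2)) i | i < n.+2].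
  have -> : (fun z : (T * T) * n.-tuple T => F (ins ord0 z.1.1 (ins j' z.1.2 (tnth z.2)))) =
      (fun z => F (tnth (h z))).
    by apply/funext => z; congr F; apply/funext => i; rewrite tnth_mktuple.
  apply: cbm_comp bF; apply/measurable_fun_tnthP => i.
  rewrite (_ : _ \o _ = fun z => ins ord0 z.1.1 (ins j' z.1.2 (tnth z.2)) i); last first.
    by apply/funext => z /=; rewrite tnth_mktuple.
  case: (unliftP ord0 i) => [i' ->|->]; last first.
    under eq_fun do rewrite ins_id.
    exact: measurableT_comp measurable_fst measurable_fst.
  under eq_fun do rewrite insK.
  case: (unliftP j' i') => [i'' ->|->]; last first.
    under eq_fun do rewrite ins_id.
    exact: measurableT_comp measurable_snd measurable_fst.
  under eq_fun do rewrite insK.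
  exact: measurableT_comp (measurable_tnth _) measurable_snd.
rewrite /Cint (Cfubini mD mD fD fD bH) /=.
apply: eq_Cint => x _; apply: eq_Cint => y _.
by congr iterint; apply/funext => g; rewrite ins_lift_ins0.
Qed.

Let Dn n : set (n.-tuple T) := [set xi | forall i, D (tnth xi i)].

Let mDn n : measurable (@Dn n).
Proof.
rewrite (_ : @Dn n = \bigcap_(i in [set: 'I_n]) ((fun t => tnth t i) @^-1` D)); last first.
  by apply/seteqP; split => [t At i _|t At i]; exact: At.
apply: fin_bigcap_measurable; first exact: finite_finset.
by move=> i _; rewrite -[X in measurable X]setTI; exact: measurable_tnth.
Qed.

Let fDn n : (power_measure mu n (@Dn n) < +oo)%E.
Proof.
rewrite (@power_measure_box _ _ _ mu n (fun=> D))//.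
suff : (\prod_(i < n) mu D)%E \is a fin_num by rewrite fin_numElt => /andP[].
elim/big_ind: _ => //; first by move=> x y; exact: fin_numM.
by move=> i _; rewrite ge0_fin_numE.
Qed.

Lemma Rintegral_power_measureS n (f : n.+1.-tuple T -> R) : bounded_measurable f ->
  \int[power_measure mu n.+1]_(t in @Dn n.+1) f t =
  \int[mu]_(x in D) \int[power_measure mu n]_(t in @Dn n) f [tuple of x :: t].
Proof.
move=> bf.
have bfc : bounded_measurable (fun z : T * n.-tuple T => f [tuple of z.1 :: z.2]).
  apply: (rbm_comp (h := fun z : T * n.-tuple T => [tuple of z.1 :: z.2]) _ bf).
  exact: measurable_cons.
have := Rintegral_prod12 mD (@mDn n) fD (@fDn n) bfc => /= <-.
rewrite /Rintegral; congr fine.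
pose phi (z : T * n.-tuple T) : n.+1.-tuple T := [tuple of z.1 :: z.2].
have mphi : measurable_fun setT phi by exact: measurable_cons.
have prephi : phi @^-1` (@Dn n.+1) = D `*` @Dn n.
  apply/seteqP; split => [[x t] /= h|[x t] /= [Dx Dt] i]; last first.
    rewrite tnth_cons; case: (unliftP ord0 i) => [i' ->|->].
      by rewrite insK.
    by rewrite ins_id.
  split=> [|i]; first by have := h ord0; rewrite tnth_cons ins_id.
  by have := h (lift ord0 i); rewrite tnth_cons insK.
(* By definition [power_measure mu n.+1] is the image of the product measure under [phi], so a
   change of variables returns to the product. *)
rewrite (@eq_measure_integral _ _ _ (@Dn n.+1)
  (pushforward (mu \x power_measure mu n)%E phi)); last first.
  by move=> A mA _.
have mf : measurable_fun setT (EFin \o f) by apply/measurable_EFinP; case: bf.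
have intf : (mu \x power_measure mu n)%E.-integrable (phi @^-1` (@Dn n.+1)) ((EFin \o f) \o phi).
  have fDD : ((mu \x power_measure mu n) (D `*` @Dn n) < +oo)%E.
    rewrite (product_measure1E mu (power_measure mu n) mD (@mDn n)).
    by rewrite lte_mul_pinfty// ?(@fDn n)// ge0_fin_numE.
  by rewrite prephi; apply: (rbm_integrable _ fDD bfc); exact: (measurableX mD (@mDn n)).
by rewrite (integral_pushforward mphi mf intf (@mDn n.+1)) prephi.
Qed.

Lemma Rintegral_power_measure0 (f : 0.-tuple T -> R) : bounded_measurable f ->
  \int[power_measure mu 0]_(t in @Dn 0) f t = f [tuple].
Proof.
move=> [mf _]; rewrite /Rintegral/= integral_dirac ?diracE; last 2 first.
- exact: (@mDn 0).
- by apply/measurable_EFinP; exact: measurable_funTS.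
by rewrite (_ : _ \in _) ?mul1e//; apply/mem_set => -[].
Qed.

Lemma Cintegral_power_measure n (F : ('I_n -> T) -> C) : tbm F ->
  Cintegral (power_measure mu n) (@Dn n) (fun xi => F (tnth xi)) = iterint F.
Proof.
elim: n F => [|n IH] F bF.
  case: bF => bR bI; rewrite /Cintegral.
  rewrite (Rintegral_power_measure0 bR) (Rintegral_power_measure0 bI) /=.
  by case: (F _).
case: (bF) => bR bI; rewrite /Cintegral.
rewrite (Rintegral_power_measureS bR) (Rintegral_power_measureS bI).
transitivity (Cint (fun x => Cintegral (power_measure mu n) (@Dn n)
    (fun t => F (tnth [tuple of x :: t])))); first by [].
change (iterint F) with (Cint (fun x => iterint (fun g => F (ins ord0 x g)))).
apply: eq_Cint => x _; rewrite -(IH (fun g => F (ins ord0 x g))); last first.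
  exact: tbm_ins0_section.
by congr Cintegral; apply/funext => t; rewrite tnth_cons.
Qed.

End iterated_integral.

(** * Fredholm minors *)

Section minors.
Context (T : Type) (F : comNzRingType) (k : T -> T -> F).

Definition minor n (r c : 'I_n -> T) : F := \det (\matrix_(i, j) k (r i) (c j)).

Lemma minor_expand n (j : 'I_n.+1) x (r : 'I_n -> T) (c : 'I_n.+1 -> T) :
  minor (ins j x r) c =
  \sum_(l < n.+1) k x (c l) * (-1) ^+ (j + l) * minor r (c \o lift l).
Proof.
rewrite /minor (expand_det_row _ j); apply: eq_bigr => l _.
rewrite mxE ins_id -mulrA; congr (_ * (_ * _)).
by congr determinant; apply/matrixP => p q; rewrite !mxE insK.
Qed.

(** The sign of moving a row to the front is read off from Laplace expansion along that row, without
    any permutation. *)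
Lemma minor_ins n (j : 'I_n.+1) x (r : 'I_n -> T) (c : 'I_n.+1 -> T) :
  minor (ins j x r) c = (-1) ^+ j * minor (ins ord0 x r) c.
Proof.
rewrite !minor_expand mulr_sumr; apply: eq_bigr => l _.
by rewrite add0n exprD; ring.
Qed.

(** Laplace expansion along the row of [x]. In the term of column [g j] the sign is [(-1)^(j+1)],
    and bringing the row of [g j] to the front costs another [(-1)^j]; so all these terms carry the
    same sign [-1]. *)
Lemma minor_bordered n x t (g : 'I_n.+1 -> T) :
  minor (ins ord0 x g) (ins ord0 t g) = k x t * minor g g -
  \sum_(j < n.+1) k x (g j) *
    minor (ins ord0 (g j) (g \o lift j)) (ins ord0 t (g \o lift j)).
Proof.
rewrite minor_expand big_ord_recl ins_id addn0 expr0 mulr1.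
have ins_lift (h : 'I_n.+1 -> T) : ins ord0 t h \o lift ord0 = h.
  by apply/funext => i /=; rewrite insK.
rewrite ins_lift; congr (_ + _); rewrite -sumrN; apply: eq_bigr => j _.
rewrite insK add0n lift0.
have -> : ins ord0 t g \o lift (lift ord0 j) = ins ord0 t (g \o lift j).
  rewrite -{1}(insE j g) -ins_lift_ins0; apply/funext => i /=; by rewrite insK.
by rewrite -{2}(insE j g) minor_ins exprS -signr_odd; case: (odd j); rewrite ?expr1 ?expr0; ring.
Qed.

End minors.

Lemma minor_tr T (F : comNzRingType) (k : T -> T -> F) n (r c : 'I_n -> T) :
  minor (fun x t => k t x) r c = minor k c r.
Proof.
by rewrite /minor -det_tr; congr determinant; apply/matrixP => i j; rewrite !mxE.
Qed.

Section fredholm_coefficients.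
Context d d' (T : measurableType d) (Y : measurableType d') (R : realType).
Variables (mu : {sigma_finite_measure set T -> \bar R}) (D : set T).
Hypotheses (mD : measurable D) (fD : (mu D < +oo)%E).
Let C := R[i].
Let Cint := Cintegral mu D.

(** [fredholm_coef] is [I_n] and [fredholm_minor_coef] below is [c_n]. The parameter [y] is an
    argument of the kernel so that measurability is joint in [(x, t, y)]. *)
Definition fredholm_coef (k : T -> T -> Y -> C) n y : C :=
  iterint mu D (fun g : 'I_n -> T => minor (fun x t => k x t y) g g).

Definition fredholm_minor_coef (k : T -> T -> Y -> C) n x t y : C :=
  iterint mu D (fun g : 'I_n -> T =>
    minor (fun x t => k x t y) (ins ord0 x g) (ins ord0 t g)).

Variable k : T -> T -> Y -> C.
Hypothesis bk : cbm (fun z : T * T * Y => k z.1.1 z.1.2 z.2).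

Lemma cbm_minor d2 (S : measurableType d2) n (r c : S -> 'I_n -> T) (h : S -> Y) :
  (forall i, measurable_fun setT (r ^~ i)) ->
  (forall i, measurable_fun setT (c ^~ i)) -> measurable_fun setT h ->
  cbm (fun s => minor (fun x t => k x t (h s)) (r s) (c s)).
Proof.
move=> mr mc mh; apply: cbm_det => i j; under eq_fun do rewrite mxE.
apply: (cbm_comp (h := fun s => (r s i, c s j, h s)) _ bk).
by apply: measurable_fun_pair => //; apply: measurable_fun_pair; [exact: mr|exact: mc].
Qed.

Lemma measurable_ins0 d2 (S : measurableType d2) n (x : S -> T) (t : S -> n.-tuple T) i :
  measurable_fun setT x -> measurable_fun setT t ->
  measurable_fun setT (fun s => ins ord0 (x s) (tnth (t s)) i).
Proof.
move=> mx mt; case: (unliftP ord0 i) => [i' ->|->]; last by under eq_fun do rewrite ins_id.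
by under eq_fun do rewrite insK; exact: measurableT_comp (measurable_tnth _) mt.
Qed.

Lemma cbm_fredholm_minor_coef n :
  cbm (fun z : T * T * Y => fredholm_minor_coef k n z.1.1 z.1.2 z.2).
Proof.
apply: (@cbm_iterint _ _ _ mu D mD fD _ (T * T * Y)%type n (fun z g =>
  minor (fun x t => k x t z.2) (ins ord0 z.1.1 g) (ins ord0 z.1.2 g))).
apply: cbm_minor => [i|i|].
- apply: measurable_ins0 => //; apply: measurableT_comp measurable_fst _.
  exact: measurableT_comp measurable_fst measurable_fst.
- apply: measurable_ins0 => //; apply: measurableT_comp measurable_snd _.
  exact: measurableT_comp measurable_fst measurable_fst.
- exact: measurableT_comp measurable_snd measurable_fst.
Qed.

Lemma tbm_minor n y : tbm (fun g : 'I_n -> T => minor (fun x t => k x t y) g g).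
Proof. by apply: (cbm_minor (h := fun=> y)) => // i; exact: measurable_tnth. Qed.

Lemma tbm_bordered_minor n x t y : tbm (fun g : 'I_n -> T =>
  minor (fun x t => k x t y) (ins ord0 x g) (ins ord0 t g)).
Proof. by apply: (cbm_minor (h := fun=> y)) => // i; exact: measurable_ins0. Qed.

Lemma fredholm_coef0 y : fredholm_coef k 0 y = 1.
Proof. by rewrite /fredholm_coef /= /minor det_mx00. Qed.

(** The trace formula holds by computation: the outermost variable of [iterint] is inserted at
    position [0] in both rows and columns, as the border is. *)
Lemma fredholm_coefS n y :
  fredholm_coef k n.+1 y = Cint (fun x => fredholm_minor_coef k n x x y).
Proof. by []. Qed.

Lemma fredholm_minor_coef0 x t y : fredholm_minor_coef k 0 x t y = k x t y.
Proof.
by rewrite /fredholm_minor_coef /= /minor det_mx11 mxE !(@ins_id _ 0 ord0).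
Qed.

Lemma fredholm_minor_coefS n x t y : fredholm_minor_coef k n.+1 x t y =
  fredholm_coef k n.+1 y * k x t y -
  n.+1%:R * Cint (fun s => k x s y * fredholm_minor_coef k n s t y).
Proof.
pose ky := fun x t => k x t y.
have bkx : cbm (fun s => k x s y).
  apply: (cbm_comp (h := fun s => (x, s, y)) _ bk).
  by apply: measurable_fun_pair => //; exact: measurable_fun_pair.
pose H (s : T) (h : 'I_n -> T) := k x s y * minor ky (ins ord0 s h) (ins ord0 t h).
have bH (j : 'I_n.+1) : tbm (fun g => H (g j) (g \o lift j)).
  apply: cbmM; first exact: (cbm_comp (measurable_tnth j) bkx).
  apply: (cbm_minor (h := fun=> y)) => // i.
  - case: (unliftP ord0 i) => [i' ->|->].
      under eq_fun do rewrite insK; exact: measurable_tnth.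
    under eq_fun do rewrite ins_id; exact: measurable_tnth.
  - case: (unliftP ord0 i) => [i' ->|->].
      under eq_fun do rewrite insK; exact: measurable_tnth.
    rewrite (_ : (fun _ => _) = cst t)//; by apply/funext => u; rewrite ins_id.
transitivity (iterint mu D (fun g : 'I_n.+1 -> T => k x t y * minor ky g g +
    (-1) * \sum_(j < n.+1) H (g j) (g \o lift j))).
  congr iterint; apply/funext => g.
  by rewrite mulN1r -minor_bordered.
have bm1 := tbm_minor n.+1 y.
have bS : tbm (fun g : 'I_n.+1 -> T => \sum_(j < n.+1) H (g j) (g \o lift j)).
  by apply: cbm_sum => j _; exact: bH.
rewrite iterintD//; [|exact: cbmZ..].
rewrite !iterintZ// mulN1r mulrC; congr (_ - _).
(* The summands become equal once [g j] is made the outermost variable: what is left is the minor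
   bordered by [s] and [t]. Hence the factor [n.+1]. *)
rewrite iterint_sum// mulr_natl -[in RHS](card_ord n.+1) -sumr_const.
apply: eq_bigr => j _; rewrite (iterint_ins mD fD j (bH j)).
apply: eq_Cint => s _.
rewrite -iterintZ//; last exact: tbm_bordered_minor.
congr iterint; apply/funext => g; rewrite ins_id.
suff -> : ins j s g \o lift j = g by [].
by apply/funext => i /=; rewrite insK.
Qed.

Variable M : R.
Hypothesis kM : forall x t y, normc (k x t y) <= M.

Lemma normc_minor_le n y (r c : 'I_n -> T) :
  normc (minor (fun x t => k x t y) r c) <= hadamard_bound M n.
Proof. by apply: normc_det_hadamard => i j; rewrite mxE. Qed.

Lemma normc_fredholm_coef_le n y :
  normc (fredholm_coef k n y) <= (2 * fine (mu D)) ^+ n * hadamard_bound M n.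
Proof.
by apply: normc_iterint_le => // [|g]; [exact: tbm_minor|exact: normc_minor_le].
Qed.

Lemma normc_fredholm_minor_coef_le n x t y :
  normc (fredholm_minor_coef k n x t y) <=
  (2 * fine (mu D)) ^+ n * hadamard_bound M n.+1.
Proof.
apply: normc_iterint_le => // [|g]; first exact: tbm_bordered_minor.
exact: normc_minor_le.
Qed.

End fredholm_coefficients.

(** * Geometrically convergent series *)

Section geometric_sums.
Variable R : realType.
Let C := R[i].
Implicit Types (u v : nat -> C) (z w : C).

(** Convergence with an explicit geometric rate: uniqueness and linearity of sums become elementary
    estimates. Coefficients satisfying [entire] supply the rate [2^-N] when the radius is
    doubled. *)
Definition gsum u z :=
  exists K : R, forall N, normc (z - \sum_(i < N) u i) <= K / 2 ^+ N.

Lemma geometric_lt (K e : R) : 0 < e -> exists N, K / 2 ^+ N < e.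
Proof.
move=> e0; exists (Num.truncn (`|K| / e)).+1.
rewrite ltr_pdivrMr ?exprn_gt0// mulrC.
have h : `|K| / e < 2 ^+ (Num.truncn (`|K| / e)).+1.
  apply: (lt_le_trans (truncnS_gt _)).
  by rewrite -natrX ler_nat ltnW// ltn_expl.
by apply: le_lt_trans (ler_norm K) _; rewrite -ltr_pdivrMr.
Qed.

Lemma geometric_eq0 (K : R) z : (forall N, normc z <= K / 2 ^+ N) -> z = 0.
Proof.
move=> h; apply: ComplexField.Normc.eq0_normc; apply/eqP.
rewrite eq_le normc_ge0 andbT leNgt; apply/negP => /(geometric_lt K)[N].
by rewrite ltNge h.
Qed.

Lemma gsum_unique u z w : gsum u z -> gsum u w -> z = w.
Proof.
move=> [K hK] [L hL]; apply/eqP; rewrite -subr_eq0; apply/eqP.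
apply: (@geometric_eq0 (K + L)) => N.
rewrite mulrDl (_ : z - w = z - \sum_(i < N) u i - (w - \sum_(i < N) u i)); last by ring.
by apply: le_trans (le_normcD _ _) _; rewrite normcN lerD.
Qed.

Lemma gsumD u v z w : gsum u z -> gsum v w -> gsum (fun n => u n + v n) (z + w).
Proof.
move=> [K hK] [L hL]; exists (K + L) => N; rewrite big_split/= mulrDl opprD addrACA.
by apply: le_trans (le_normcD _ _) _; apply: lerD; [exact: hK|exact: hL].
Qed.

Lemma gsumZ c u z : gsum u z -> gsum (fun n => c * u n) (c * z).
Proof.
move=> [K hK]; exists (normc c * K) => N; rewrite -mulr_sumr -mulrBr.
by rewrite ComplexField.Normc.normcM -mulrA ler_wpM2l// normc_ge0.
Qed.

Lemma gsum_cons c u z : gsum u z ->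
  gsum (fun n => if n is m.+1 then u m else c) (c + z).
Proof.
(* The first bound serves the empty sum, the second the loss of a factor [2] by the shift of
   indices. *)
move=> [K hK]; exists (Num.max (normc (c + z)) (2 * K)) => -[|N].
  by rewrite big_ord0 subr0 expr0 divr1 le_max lexx.
rewrite big_ord_recl/= opprD addrACA subrr add0r.
apply: (le_trans (hK N)); rewrite ler_pdivlMr ?exprn_gt0// exprS mulrCA divfK ?expf_neq0//.
by rewrite mulrC le_max lexx orbT.
Qed.

Let gsumR (u : nat -> R) K : (forall n, `|u n| <= K / 2 ^+ n) ->
  exists r : R, forall N, `|r - \sum_(i < N) u i| <= 2 * K / 2 ^+ N.
Proof.
move=> uK.
have K0 : 0 <= K by have := uK 0; rewrite expr0 divr1; exact: le_trans.
pose s N := \sum_(i < N) u i.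
have halve N : K / 2 ^+ N = 2 * K / 2 ^+ N.+1.
  by rewrite exprS invfM mulrACA divff ?mul1r.
(* Nested intervals around the partial sums: the half-width [2 K / 2^N] shrinks by exactly
   [K / 2^N], the bound on the next term. The sum of the series is the infimum of the right ends. *)
pose v N := s N + 2 * K / 2 ^+ N; pose w N := s N - 2 * K / 2 ^+ N.
have vS N : v N.+1 <= v N /\ w N <= w N.+1.
  rewrite /v /w /s big_ord_recr/= -halve.
  by have := uK N; rewrite ler_norml => /andP[]; split; lra.
have wv N : w N <= v N.
  have : 0 <= 2 * K / 2 ^+ N by rewrite divr_ge0 ?exprn_ge0 ?mulr_ge0.
  rewrite /v /w; lra.
have vle m n : v (m + n)%N <= v m.
  by elim: n => [|n IH]; rewrite ?addn0// addnS; apply: le_trans IH; case: (vS (m + n)%N).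
have wle m n : w m <= w (m + n)%N.
  by elim: n => [|n IH]; rewrite ?addn0// addnS; apply: le_trans IH _; case: (vS (m + n)%N).
have wv2 m n : w m <= v n.
  apply: le_trans (wle m n) _; apply: le_trans (wv _) _.
  by rewrite addnC.
exists (inf (range v)) => N; rewrite ler_distl; apply/andP; split.
  apply: lb_le_inf; first by exists (v 0).
  by move=> _ [n _ <-]; exact: wv2.
apply: ge_inf; last by exists N.
by exists (w 0) => _ [n _ <-]; exact: wv2.
Qed.

Lemma gsum_exists u K : (forall n, normc (u n) <= K / 2 ^+ n) ->
  exists z, forall N, normc (z - \sum_(i < N) u i) <= 4 * K / 2 ^+ N.
Proof.
move=> uK.
have [|x hx] := @gsumR (fun n => Re (u n)) K.
  by move=> n; exact: le_trans (normr_Re_le _) (uK n).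
have [|y hy] := @gsumR (fun n => Im (u n)) K.
  by move=> n; exact: le_trans (normr_Im_le _) (uK n).
exists (x +i* y)%C => N; apply: le_trans (normc_le_ReIm _) _.
have ReS : Re (\sum_(i < N) u i) = \sum_(i < N) Re (u i).
  by elim/big_ind2: _ => // ? ? ? ? <- <-; rewrite ReD.
have ImS : Im (\sum_(i < N) u i) = \sum_(i < N) Im (u i).
  by elim/big_ind2: _ => // ? ? ? ? <- <-; rewrite ImD.
rewrite ReD ImD ReN ImN ReS ImS /=.
have := hx N; have := hy N; lra.
Qed.

(* [0] when [u] has no sum in the sense of [gsum]. *)
Definition csum u : C := xget 0 [set z | gsum u z].

Lemma csum_gsum u z : gsum u z -> csum u = z.
Proof.
move=> uz; apply: (gsum_unique _ uz); rewrite /csum; case: xgetP => [y -> //|h]. by case: (h z).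
Qed.

Lemma csumP u K : (forall n, normc (u n) <= K / 2 ^+ n) ->
  forall N, normc (csum u - \sum_(i < N) u i) <= 4 * K / 2 ^+ N.
Proof.
by move=> /gsum_exists[z hz]; rewrite (@csum_gsum u z)//; exists (4 * K).
Qed.

Lemma gsum_csum u K : (forall n, normc (u n) <= K / 2 ^+ n) -> gsum u (csum u).
Proof. by move=> /csumP h; exists (4 * K). Qed.

End geometric_sums.

Section gsum_functions.
Context d (T : measurableType d) (R : realType).
Variables (mu : {measure set T -> \bar R}) (D : set T).
Hypotheses (mD : measurable D) (fD : (mu D < +oo)%E).
Variables (f : nat -> T -> R[i]) (K : R).
Hypotheses (bf : forall n, cbm (f n)).
Hypothesis fK : forall n x, normc (f n x) <= K / 2 ^+ n.

Lemma cbm_csum : cbm (fun x => csum (f ^~ x)).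
Proof.
pose s N x := \sum_(i < N) f i x.
have bs N : cbm (s N) by apply: cbm_sum => i _; exact: bf.
have h x N : normc (csum (f ^~ x) - s N x) <= 4 * K / 2 ^+ N by exact: csumP.
have lim (g : R[i] -> R) : (forall z w, `|g z - g w| <= normc (z - w)) ->
    (forall N, measurable_fun setT (g \o s N)) ->
    measurable_fun setT (fun x => g (csum (f ^~ x))).
  move=> glip mg; apply: (measurable_fun_cvg mg) => x _.
  apply/cvgrPdist_lt => e e0.
  have [N hN] := geometric_lt (4 * K) e0.
  near=> n; apply: le_lt_trans (glip _ _) _; apply: le_lt_trans (h x n) _.
  apply: le_lt_trans hN; rewrite ler_pdivrMr ?exprn_gt0// mulrAC ler_pdivlMr ?exprn_gt0//.
  apply: ler_wpM2l; last first.
    rewrite ler_eXn2l ?ltr1n//; near: n; exact: nbhs_infty_ge.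
  have := le_trans (normc_ge0 _) (fK 0 x); rewrite expr0 divr1; lra.
apply/cbmP; split.
- apply: lim => [z w|N]; last by case: (bs N) => -[].
  by rewrite -ReN -ReD; exact: normr_Re_le.
- apply: lim => [z w|N]; last by case: (bs N) => _ [].
  by rewrite -ImN -ImD; exact: normr_Im_le.
- exists (4 * K) => x; have := h x 0.
  by rewrite /s big_ord0 subr0 expr0 divr1.
Unshelve. all: by end_near.
Qed.

(** The rate is uniform in [x], so integrating the remainder over [D] costs only the factor
    [2 mu(D)], and no limit theorem is needed. *)
Lemma gsum_Cint :
  gsum (fun n => Cintegral mu D (f n)) (Cintegral mu D (fun x => csum (f ^~ x))).
Proof.
exists (2 * fine (mu D) * (4 * K)) => N.
have bs : cbm (fun x => \sum_(i < N) f i x) by apply: cbm_sum => i _; exact: bf.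
rewrite -Cint_sum// -CintN// -CintD//; [|exact: cbm_csum|exact: cbmN].
rewrite -(mulrA (2 * fine (mu D))); apply: (normc_Cint_le mD fD).
  by apply: cbmD; [exact: cbm_csum|exact: cbmN].
by move=> x; exact: csumP.
Qed.

End gsum_functions.

(** * Derivatives of exponential generating series *)

Lemma leq_bin_exp2 n m : ('C(n, m) <= 2 ^ n)%N.
Proof.
elim: n m => [|n IH] [|m] //; first by rewrite bin0 expn_gt0.
by rewrite binS expnS mul2n -addnn leq_add.
Qed.

Lemma sum_half_le (R : realType) n : \sum_(j < n) (2 ^+ j)^-1 <= 2 :> R.
Proof.
suff -> : \sum_(j < n) (2 ^+ j)^-1 = 2 - 2 / 2 ^+ n :> R.
  by rewrite gerBl divr_ge0// exprn_ge0.
elim: n => [|n IH]; first by rewrite big_ord0 expr0; lra.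
by rewrite big_ord_recr/= IH exprS invfM mulrA divff// mul1r; lra.
Qed.

Lemma natf_fact_neq0 (R : numDomainType) n : n`!%:R != 0 :> R.
Proof. by rewrite pnatr_eq0 -lt0n fact_gt0. Qed.

Section egf.
Variable R : realType.
Let C := R[i].
Variable kappa : C.
Implicit Types z a i : nat -> C.

Definition egf_term z j n : C :=
  (-1) ^+ (n + j) * kappa ^+ n / n`!%:R * z (n + j)%N.

(* The [j]-th derivative at [kappa] of [sum_n (-t)^n / n! z_n]. *)
Definition egf z j : C := csum (egf_term z j).

Lemma normc_egf_term z j n :
  normc (egf_term z j n) = normc kappa ^+ n / n`!%:R * normc (z (n + j)%N).
Proof.
rewrite /egf_term !ComplexField.Normc.normcM ComplexField.Normc.normcV.
rewrite !normcX normc_nat normcN ComplexField.Normc.normc1 expr1n mul1r.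
by [].
Qed.

(** This is [entire] at radius [2 |kappa|]. The constant is chosen before [z]: it depends on the
    majorant alone, which makes later estimates uniform in the points of evaluation. *)
Lemma egf_term_le (b : nat -> R) j : entire b -> exists K, forall z,
  (forall n, normc (z n) <= b n) -> forall n, normc (egf_term z j n) <= K / 2 ^+ n.
Proof.
move=> eb; have [K hK] := entire_shiftn j eb (mulr_ge0 (ler0n _ 2) (normc_ge0 kappa)).
exists K => z zb n; rewrite normc_egf_term mulrAC.
rewrite ler_pdivrMr ?ltr0n ?fact_gt0// mulrAC ler_pdivlMr ?exprn_gt0//.
apply: le_trans (hK n); rewrite exprMn [leLHS]mulrAC mulrC.
rewrite [_ * 2 ^+ n]mulrC ler_wpM2r//.
  by rewrite mulr_ge0 ?exprn_ge0// normc_ge0.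
exact: le_trans (zb _) (ler_norm _).
Qed.

Lemma gsum_egf (b : nat -> R) z j : entire b -> (forall n, normc (z n) <= b n) ->
  gsum (egf_term z j) (egf z j).
Proof. by move=> /(egf_term_le j)[K hK] /hK; exact: gsum_csum. Qed.

(** The term [- m a_(m-1)] corresponds to multiplying the generating function of [a] by the variable
    [t], and the [j]-th derivative of [t A] is [t A_j + j A_(j-1)]. In coefficients this is the
    splitting of [m = n + j]. Predecessors of [0] always come with the factor [0]. *)
Lemma egf_recurrence (b : nat -> R) z i a c j : entire b ->
  (forall n, normc (z n) <= b n) -> (forall n, normc (i n) <= b n) ->
  (forall n, normc (a n) <= b n) ->
  (forall m, z m = i m * c - m%:R * a m.-1) ->
  egf z j = egf i j * c + kappa * egf a j + j%:R * egf a j.-1.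
Proof.
move=> eb zb ib ab zE; apply: gsum_unique (gsum_egf j eb zb) _.
have h1 := gsumZ c (gsum_egf j eb ib).
have h2 := gsum_cons 0 (gsumZ kappa (gsum_egf j eb ab)).
have h3 := gsumZ j%:R (gsum_egf j.-1 eb ab).
have := gsumD (gsumD h1 h2) h3; rewrite add0r [c * _]mulrC.
congr (gsum _ _); apply/funext => n; rewrite /egf_term zE natrD.
have jE : j%:R * ((-1) ^+ (n + j.-1) * kappa ^+ n / n`!%:R * a (n + j.-1)%N) =
    - (j%:R * ((-1) ^+ (n + j) * kappa ^+ n / n`!%:R * a (n + j).-1)).
  by case: j {h1 h2 h3} => [|j]; rewrite ?mul0r ?oppr0// addnS /= exprS; ring.
rewrite jE; case: n {jE} => [|n]; first by rewrite mulr0n; ring.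
rewrite addSn /= !exprS factS natrM.
have n1 : n.+1%:R != 0 :> C by rewrite pnatr_eq0.
have n2 : n`!%:R != 0 :> C by rewrite pnatr_eq0 -lt0n fact_gt0.
by field; rewrite n2 -[1]/(1%:R) -natrD add1n n1.
Qed.

(* All derivatives of an entire function cannot vanish at [kappa], unless its
   value at [0] does: only finite truncations of its Taylor series are used. *)
Lemma egf_eq0 (b : nat -> R) z : entire b -> (forall n, normc (z n) <= b n) ->
  (forall j, egf z j = 0) -> z 0 = 0.
Proof.
move=> eb zb z0.
pose a N := kappa ^+ N / N`!%:R * z N.
(* The Taylor expansion around [kappa], evaluated at [0], with each derivative written as a series
   and everything truncated to [n + j < L]. *)
pose S L : C := \sum_(j < L) \sum_(n < L - j) ((-1) ^+ n *+ 'C(n + j, j)) * a (n + j)%N.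
have SE L : S L.+1 = z 0.
  elim: L => [|L IH].
    by rewrite /S !big_ord1 /= bin0 mulr1n /a expr0 fact0 invr1 !mul1r.
  rewrite -{}IH /S [LHS]big_ord_recr /= subSnn big_ord1 add0n.
  rewrite (eq_bigr (fun j : 'I_L.+1 =>
    \sum_(n < L.+1 - j) (-1) ^+ n *+ 'C(n + j, j) * a (n + j)%N +
    (-1) ^+ (L.+1 - j) *+ 'C(L.+1, j) * a L.+1)); last first.
    move=> j _; have jL : (j <= L.+1)%N by rewrite ltnW.
    by rewrite subSn// big_ord_recr/= subnK.
  rewrite big_split/= -addrA -[RHS]addr0; congr (_ + _).
  rewrite -mulr_suml -mulrDl.
  (* Raising the truncation by one adds the diagonal [n + j = L.+1], whose coefficients sum to
     [(1 - 1)^(L+1) = 0]. *)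
  have := exprDn (-1 : C) 1 L.+1; rewrite addNr expr0n /= big_ord_recr /=.
  rewrite subnn expr0 expr1n mul1r => h.
  rewrite (_ : _ + _ = 0) ?mul0r// [RHS]h; congr (_ + _).
  by apply: eq_bigr => j _; rewrite expr1n mulr1.
(* Of the decay [8^-(n+j)], a factor [2^(n+j)] is spent on the binomial coefficient. From the
   remaining [4^-(n+j)], the rate [2^-n] is kept in [n], and [4^-j] covers the loss [2^j] from
   stopping at [L - j] while leaving a summable [2^-j]. *)
have [K hK] := eb (8 * normc kappa) (mulr_ge0 (ler0n _ 8) (normc_ge0 kappa)).
have K0 : 0 <= K by have := hK 0; rewrite expr0 fact0 !mulr1; exact: le_trans.
have aK N : normc (a N) <= K / 8 ^+ N.
  rewrite /a !ComplexField.Normc.normcM ComplexField.Normc.normcV normcX normc_nat.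
  rewrite mulrAC ler_pdivrMr ?ltr0n ?fact_gt0// mulrAC ler_pdivlMr ?exprn_gt0//.
  apply: le_trans (hK N); rewrite exprMn.
  have := ler_wpM2l (mulr_ge0 (exprn_ge0 N (ler0n R 8)) (exprn_ge0 N (normc_ge0 kappa)))
    (le_trans (zb N) (ler_norm _)).
  lra.
(* Up to a constant factor the inner sum is a partial sum of the series of [egf z j], which is [0];
   so it is as small as the remainder. *)
have step j L : (j <= L)%N ->
    normc (\sum_(n < L - j) ((-1) ^+ n *+ 'C(n + j, j)) * a (n + j)%N) <=
    4 * K / 2 ^+ L / 2 ^+ j.
  move=> jL; pose u n := ((-1) ^+ n *+ 'C(n + j, j)) * a (n + j)%N.
  have uE n : u n = (-1) ^+ j * (kappa ^+ j / j`!%:R) * egf_term z j n.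
    have binE : 'C(n + j, j)%:R = (n + j)`!%:R / (j`!%:R * n`!%:R) :> C.
      by rewrite -(bin_fact (leq_addl n j)) addnK !natrM mulfK// mulf_neq0// natf_fact_neq0.
    rewrite /u /egf_term /a -mulr_natr binE !exprD -[in LHS](signrMK j ((-1) ^+ n)).
    by field; rewrite !natf_fact_neq0.
  have u0 : gsum u 0.
    have := gsumZ ((-1) ^+ j * (kappa ^+ j / j`!%:R)) (gsum_egf j eb zb).
    by rewrite z0 mulr0; congr gsum; apply/funext => n; rewrite uE.
  have uK n : normc (u n) <= (K / 4 ^+ j) / 2 ^+ n.
    rewrite /u mulrnAl normcMn ComplexField.Normc.normcM normcX normcN.
    rewrite ComplexField.Normc.normc1 expr1n mul1r -[leLHS]mulr_natl.
    have b2 : 'C(n + j, j)%:R <= 2 ^+ (n + j) :> R by rewrite -natrX ler_nat leq_bin_exp2.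
    apply: le_trans (ler_pM (ler0n _ _) (normc_ge0 _) b2 (aK _)) _.
    rewrite mulrCA -exprVn -exprMn (_ : 2 * 8^-1 = 4^-1 :> R); last by lra.
    rewrite exprD [4^-1 ^+ n * _]mulrC mulrA -(exprVn 4 j) -(exprVn 2 n).
    apply: ler_wpM2l; first by rewrite mulr_ge0// exprn_ge0// invr_ge0.
    by rewrite lerXn2r ?nnegrE; lra.
  have := csumP uK (L - j); rewrite (csum_gsum u0) sub0r normcN.
  move=> /le_trans; apply.
  rewrite -[in leRHS](subnK jL) exprD (_ : 4 = 2 * 2 :> R); last by lra.
  rewrite exprMn le_eqVlt; apply/orP; left; apply/eqP.
  by field; rewrite !expf_neq0.
apply: (@geometric_eq0 _ (8 * K)) => N.
rewrite -(SE N); apply: le_trans (normc_sum_le _ _ _) _.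
apply: (@le_trans _ _ (\sum_(j < N.+1) 4 * K / 2 ^+ N.+1 / 2 ^+ j)).
  by apply: ler_sum => j _; apply: step; rewrite ltnW.
rewrite -mulr_sumr exprS invfM.
have p : 0 <= 4 * K * (2^-1 / 2 ^+ N) by rewrite !mulr_ge0// invr_ge0 exprn_ge0.
have := ler_wpM2l p (sum_half_le R N.+1); lra.
Qed.

End egf.

(** * Fredholm determinant and first minor *)

Section fredholm_functions.
Context d d' (T : measurableType d) (Y : measurableType d') (R : realType).
Variables (mu : {sigma_finite_measure set T -> \bar R}) (D : set T).
Hypotheses (mD : measurable D) (fD : (mu D < +oo)%E).
Let C := R[i].
Let Cint := Cintegral mu D.
Variable kappa : C.

(* [j]-th derivatives in [kappa] of the Fredholm determinant and of the first
   Fredholm minor. *)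
Definition fredholm_D (k : T -> T -> Y -> C) j y : C :=
  egf kappa (fun n => fredholm_coef mu D k n y) j.

Definition fredholm_G (k : T -> T -> Y -> C) j x t y : C :=
  egf kappa (fun n => fredholm_minor_coef mu D k n x t y) j.

Variable k : T -> T -> Y -> C.
Hypothesis bk : cbm (fun z : T * T * Y => k z.1.1 z.1.2 z.2).
Variable M : R.
Hypothesis kM : forall x t y, normc (k x t y) <= M.

Lemma cbm_section1 x y (G : T -> T -> Y -> C) :
  cbm (fun z : T * T * Y => G z.1.1 z.1.2 z.2) -> cbm (fun s => G x s y).
Proof.
move=> bG; apply: (cbm_comp (h := fun s => (x, s, y)) _ bG).
by apply: measurable_fun_pair => //; exact: measurable_fun_pair.
Qed.

Lemma cbm_section2 t y (G : T -> T -> Y -> C) :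
  cbm (fun z : T * T * Y => G z.1.1 z.1.2 z.2) -> cbm (fun s => G s t y).
Proof.
move=> bG; apply: (cbm_comp (h := fun s => (s, t, y)) _ bG).
by apply: measurable_fun_pair => //; exact: measurable_fun_pair.
Qed.

Lemma cbm_diag y (G : T -> T -> Y -> C) :
  cbm (fun z : T * T * Y => G z.1.1 z.1.2 z.2) -> cbm (fun s => G s s y).
Proof.
move=> bG; apply: (cbm_comp (h := fun s => (s, s, y)) _ bG).
by apply: measurable_fun_pair => //; exact: measurable_fun_pair.
Qed.

(** [egf_recurrence] asks for a single majorant of [I_n], [c_n] and [K c_n], hence the sum of the
    three bounds; [2 m |M|] is the cost of applying [K]. *)
Let coef_bound : exists2 b : nat -> R, entire b & forall n,
  [/\ forall y, normc (fredholm_coef mu D k n y) <= b n,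
      forall x t y, normc (fredholm_minor_coef mu D k n x t y) <= b n &
      forall x t y, normc (Cint (fun s => k x s y * fredholm_minor_coef mu D k n s t y)) <= b n].
Proof.
pose m := fine (mu D).
have m0 : 0 <= m by rewrite fine_ge0.
have hb0 n : 0 <= hadamard_bound M n by exact: sqrtr_ge0.
pose cb n := (2 * m) ^+ n * hadamard_bound M n.+1.
have cb0 n : 0 <= cb n by rewrite mulr_ge0// exprn_ge0// mulr_ge0.
exists (fun n => (2 * m) ^+ n * hadamard_bound M n + (1 + 2 * m * `|M|) * cb n).
  move=> rho r0.
  have [K1 h1] := entire_scale 1 (2 * m) (entire_hadamard M) r0.
  have [K2 h2] := entire_scale (1 + 2 * m * `|M|) (2 * m) (entire_shift (entire_hadamard M)) r0.
  exists (K1 + K2) => n; have := h1 n; have := h2 n; rewrite mul1r /cb mulrA.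
  move=> g2 g1; apply: le_trans (ler_wpM2r (exprn_ge0 n r0) (ler_normD _ _)) _.
  by rewrite mulrDl [leRHS]mulrDl; exact: lerD.
move=> n; have p0 : 0 <= (2 * m) ^+ n * hadamard_bound M n.
  by rewrite mulr_ge0// exprn_ge0// mulr_ge0.
have p1 : 0 <= 2 * m * `|M| * cb n by rewrite mulr_ge0// mulr_ge0// mulr_ge0.
have := cb0 n; split=> [y|x t y|x t y].
- have := normc_fredholm_coef_le mD fD bk kM n y; rewrite -/m; lra.
- have := normc_fredholm_minor_coef_le mD fD bk kM n x t y; rewrite -/m -/(cb n); lra.
- have h : normc (Cint (fun s => k x s y * fredholm_minor_coef mu D k n s t y)) <=
      2 * m * (`|M| * cb n).
    apply: (normc_Cint_le mD fD).
      apply: cbmM; first exact: cbm_section1.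
      exact: cbm_section2 (cbm_fredholm_minor_coef mD fD bk n).
    move=> s; rewrite ComplexField.Normc.normcM ler_pM ?normc_ge0//.
      exact: le_trans (kM _ _ _) (ler_norm _).
    exact: (normc_fredholm_minor_coef_le mD fD bk kM).
  lra.
Qed.

Lemma fredholm_D_S j y :
  fredholm_D k j.+1 y = - Cint (fun x => fredholm_G k j x x y).
Proof.
have [b eb hb] := coef_bound.
have [K hK] := egf_term_le kappa j eb.
have hG x n : normc (egf_term kappa
    (fun n => fredholm_minor_coef mu D k n x x y) j n) <= K / 2 ^+ n.
  by apply: hK => l; case: (hb l).
have bt n : cbm (fun x => egf_term kappa (fun n => fredholm_minor_coef mu D k n x x y) j n).
  by apply: cbmZ; exact: cbm_diag (cbm_fredholm_minor_coef mD fD bk _).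
have := gsumZ (-1) (gsum_Cint mD fD bt (fun n x => hG x n)).
rewrite mulN1r -/(fredholm_G k j _ _ y) => h.
rewrite /fredholm_D /egf; apply: csum_gsum.
move: h; congr gsum; apply/funext => n.
rewrite /egf_term CintZ//; last first.
  exact: cbm_diag (cbm_fredholm_minor_coef mD fD bk _).
by rewrite addnS fredholm_coefS exprS; ring.
Qed.

Lemma cbm_fredholm_G j : cbm (fun z : T * T * Y => fredholm_G k j z.1.1 z.1.2 z.2).
Proof.
have [b eb hb] := coef_bound; have [K hK] := egf_term_le kappa j eb.
apply: (@cbm_csum _ _ _ (fun n z => egf_term kappa
  (fun n => fredholm_minor_coef mu D k n z.1.1 z.1.2 z.2) j n) K).
  by move=> n; apply: cbmZ; exact: (cbm_fredholm_minor_coef mD fD bk).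
by move=> n z; apply: hK => l; case: (hb l).
Qed.

Lemma fredholm_G_rec j x t y : fredholm_G k j x t y =
  fredholm_D k j y * k x t y +
  kappa * Cint (fun s => k x s y * fredholm_G k j s t y) +
  j%:R * Cint (fun s => k x s y * fredholm_G k j.-1 s t y).
Proof.
have [b eb hb] := coef_bound.
pose a n := Cint (fun s => k x s y * fredholm_minor_coef mu D k n s t y).
(* Termwise integration: [K] applied to the [i]-th derivative of the minor is the [i]-th derivative
   of the series with coefficients [K c_n]. *)
have aE i : Cint (fun s => k x s y * fredholm_G k i s t y) = egf kappa a i.
  have [K hK] := egf_term_le kappa i eb.
  pose c s n := fredholm_minor_coef mu D k n s t y.
  have hG s n : normc (egf_term kappa (c s) i n) <= K / 2 ^+ n.
    by apply: hK => l; case: (hb l) => _ h _; exact: h.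
  have bc n : cbm (c ^~ n).
    exact: cbm_section2 (cbm_fredholm_minor_coef mD fD bk _).
  have bkx : cbm (fun s => k x s y) by exact: cbm_section1.
  have bt n : cbm (fun s => k x s y * egf_term kappa (c s) i n).
    apply: cbmM => //.
    exact: (cbmZ _ (bc (n + i)%N)).
  have hM n s : normc (k x s y * egf_term kappa (c s) i n) <=
      `|M| * K / 2 ^+ n.
    rewrite ComplexField.Normc.normcM -mulrA ler_pM ?normc_ge0//.
    exact: le_trans (kM _ _ _) (ler_norm _).
  have := gsum_Cint mD fD bt hM.
  have -> : (fun s => csum (fun n => k x s y * egf_term kappa (c s) i n)) =
      (fun s => k x s y * fredholm_G k i s t y).
    apply/funext => s; apply: csum_gsum; apply: gsumZ.
    exact: gsum_csum (hG s).
  move=> h; apply/esym/csum_gsum; move: h; congr gsum; apply/funext => n.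
  rewrite /egf_term /a /c -CintZ//; last exact: cbmM bkx (bc _).
  by apply: eq_Cint => s _; ring.
rewrite !aE; apply: (@egf_recurrence _ kappa b (fun n => fredholm_minor_coef mu D k n x t y)
  (fun n => fredholm_coef mu D k n y) a (k x t y) j eb).
- by move=> n; case: (hb n) => _ h _; exact: h.
- by move=> n; case: (hb n) => h _ _; exact: h.
- by move=> n; case: (hb n) => _ _; exact.
case=> [|n] /=.
  by rewrite fredholm_minor_coef0 fredholm_coef0 mul1r mulr0n mul0r subr0.
exact: fredholm_minor_coefS.
Qed.

(** Otherwise [egf_eq0] would make the constant coefficient vanish, but the empty determinant is
    [1]. *)
Lemma exists_fredholm_D_neq0 y : exists j, fredholm_D k j y != 0.
Proof.
apply/not_existsP => h; have [b eb hb] := coef_bound.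
have /eqP := oner_neq0 C; apply; rewrite -(fredholm_coef0 mu D k y).
apply: (@egf_eq0 _ kappa b (fun n => fredholm_coef mu D k n y) eb) => [n|j]; first by case: (hb n).
by apply/eqP/negPn/negP; exact: h.
Qed.

Lemma gsum_fredholm_D0 y :
  gsum (fun n => (- kappa) ^+ n / n`!%:R * fredholm_coef mu D k n y) (fredholm_D k 0 y).
Proof.
have [b eb hb] := coef_bound.
have [|K hK] := @gsum_egf _ kappa b (fun n => fredholm_coef mu D k n y) 0 eb.
  by move=> n; case: (hb n).
exists K => N; have := hK N; congr (normc (_ - _) <= _); apply: eq_bigr => n _.
by rewrite /egf_term addn0 -exprMn mulN1r.
Qed.

End fredholm_functions.

(** * The transposed kernel and injectivity *)

Section transpose.
Context d d' (T : measurableType d) (Y : measurableType d') (R : realType).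
Variables (mu : {sigma_finite_measure set T -> \bar R}) (D : set T).
Hypotheses (mD : measurable D) (fD : (mu D < +oo)%E).
Let C := R[i].
Let Cint := Cintegral mu D.
Variables (kappa : C) (k : T -> T -> Y -> C).
Hypothesis bk : cbm (fun z : T * T * Y => k z.1.1 z.1.2 z.2).
Variable M : R.
Hypothesis kM : forall x t y, normc (k x t y) <= M.

(** Transposing the kernel leaves determinants unchanged and swaps the two borders, so this is
    [fredholm_G_rec] for the transposed kernel. *)
Lemma fredholm_G_rec_tr x t y : fredholm_G mu D kappa k 0 x t y =
  fredholm_D mu D kappa k 0 y * k x t y +
  kappa * Cint (fun s => fredholm_G mu D kappa k 0 x s y * k s t y).
Proof.
pose k' x t y := k t x y.
have bk' : cbm (fun z : T * T * Y => k' z.1.1 z.1.2 z.2).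
  apply: (cbm_comp (h := fun z : T * T * Y => (z.1.2, z.1.1, z.2)) _ bk).
  apply: measurable_fun_pair => //; apply: measurable_fun_pair.
  - exact: measurableT_comp measurable_snd measurable_fst.
  - exact: measurableT_comp measurable_fst measurable_fst.
have DE : fredholm_D mu D kappa k 0 y = fredholm_D mu D kappa k' 0 y.
  apply: (congr1 (fun z => egf kappa z 0)); apply/funext => n.
  apply: (congr1 (@iterint _ _ _ mu D n)); apply/funext => g.
  exact: esym (minor_tr (fun x t => k x t y) _ _).
have GE u v : fredholm_G mu D kappa k 0 u v y = fredholm_G mu D kappa k' 0 v u y.
  apply: (congr1 (fun z => egf kappa z 0)); apply/funext => n.
  apply: (congr1 (@iterint _ _ _ mu D n)); apply/funext => g.
  exact: esym (minor_tr (fun x t => k x t y) _ _).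
have k'M u v w : normc (k' u v w) <= M by exact: kM.
rewrite GE DE.
rewrite (fredholm_G_rec mD fD kappa bk' k'M 0 t x y).
rewrite mulr0n mul0r addr0.
congr (_ + _).
congr (_ * _).
by apply: eq_Cint => s _; rewrite GE mulrC.
Qed.

(** Applying [G = D k + kappa G K] to [psi] gives [G psi = D K psi + G (kappa K psi)]. The last term
    is [G psi] again, so [D K psi = 0]. The equation is assumed at every point, hence [psi] vanishes
    at every point. *)
Lemma fredholm_injective y (psi : T -> C) : cbm psi ->
  (forall x, psi x = kappa * Cint (fun s => k x s y * psi s)) ->
  fredholm_D mu D kappa k 0 y != 0 -> forall x, psi x = 0.
Proof.
move=> bpsi psiE D0 x.
pose G x s := fredholm_G mu D kappa k 0 x s y.
have bG : cbm (G x) by exact: (cbm_section1 x y (cbm_fredholm_G mD fD kappa bk kM 0)).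
have bkx u : cbm (fun s => k u s y) by exact: (cbm_section1 u y bk).
have bkt u : cbm (fun s => k s u y) by exact: (cbm_section2 u y bk).
pose K u := Cint (fun s => k u s y * psi s).
have bGk : cbm (fun z : T * T => G x z.2 * (k z.2 z.1 y)).
  apply: cbmM; first exact: cbm_comp measurable_snd bG.
  apply: (cbm_comp (h := fun z : T * T => (z.2, z.1, y)) _ bk).
  by apply: measurable_fun_pair => //; exact: measurable_fun_pair.
have bH : cbm (fun t => Cint (fun s => G x s * k s t y)).
  exact: (@cbm_Cint _ _ T T R mu D (fun z => G x z.2 * k z.2 z.1 y)).
have e1 : Cint (fun t => G x t * psi t) = fredholm_D mu D kappa k 0 y * K x +
    kappa * Cint (fun t => Cint (fun s => G x s * k s t y) * psi t).
  rewrite /K /Cint -!CintZ//; [|exact: cbmM..].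
  rewrite -CintD//; [|by apply: cbmZ; exact: cbmM..].
  apply: eq_Cint => t _.
  have -> : G x t = fredholm_D mu D kappa k 0 y * k x t y +
      kappa * Cint (fun s => G x s * k s t y) by exact: fredholm_G_rec_tr.
  rewrite /Cint; ring.
have e2 : Cint (fun t => Cint (fun s => G x s * k s t y) * psi t) =
    Cint (fun s => G x s * K s).
  transitivity (Cint (fun t => Cint (fun s => G x s * k s t y * psi t))).
    apply: eq_Cint => t _; rewrite mulrC -CintZ//; last exact: cbmM.
    by apply: eq_Cint => s _; rewrite mulrC.
  rewrite /Cint (@Cfubini _ _ T T R mu mu D D mD mD fD fD
    (fun z => G x z.2 * k z.2 z.1 y * psi z.1)); last first.
    by apply: cbmM bGk _; exact: cbm_comp measurable_fst bpsi.
  apply: eq_Cint => s _; rewrite -CintZ//; last exact: cbmM.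
  by apply: eq_Cint => t _; rewrite mulrA.
have e3 : kappa * Cint (fun s => G x s * K s) = Cint (fun s => G x s * psi s).
  have bK : cbm K.
    apply: (@cbm_Cint _ _ T T R mu D (fun z => k z.1 z.2 y * psi z.2)) => //.
    apply: cbmM; last exact: cbm_comp measurable_snd bpsi.
    apply: (cbm_comp (h := fun z : T * T => (z.1, z.2, y)) _ bk).
    by apply: measurable_fun_pair => //; exact: measurable_fun_pair.
  rewrite /Cint -CintZ//; last exact: cbmM.
  by apply: eq_Cint => s _; rewrite [psi s]psiE mulrCA.
move: e1; rewrite e2 e3 => /eqP; rewrite eq_sym -subr_eq0 addrK mulf_eq0 (negbTE D0)/=.
by move=> /eqP Kx; rewrite psiE -/(K x) Kx mulr0.
Qed.

End transpose.

(** * Null sets and Tonelli on products *)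

Section product_integrals.
Context d1 d2 (T1 : measurableType d1) (T2 : measurableType d2) (R : realType).
Variables (m2 : {sigma_finite_measure set T2 -> \bar R}) (D2 : set T2).
Hypothesis (mD2 : measurable D2).
Local Open Scope ereal_scope.

Let ge0_measurable_integral (f : T1 * T2 -> \bar R) :
  measurable_fun setT f -> (forall z, 0 <= f z) ->
  measurable_fun setT (fun x => \int[m2]_(y in D2) f (x, y)).
Proof.
move=> mf f0; pose g := f \_ (setT `*` D2).
have mg : measurable_fun setT g.
  apply/(measurable_restrictT _ _).1; first exact: measurableX.
  exact: measurable_funTS.
have g0 z : 0 <= g z by rewrite /g patchE; case: ifP.
rewrite (_ : (fun _ => _) = fubini_F m2 g); first exact: measurable_fun_fubini_tonelli_F.
apply/funext => x; rewrite integral_mkcond; apply: eq_integral => y _.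
by rewrite /g !patchE in_setX in_setT.
Qed.

Lemma emeasurable_integral (f : T1 * T2 -> \bar R) : measurable_fun setT f ->
  measurable_fun setT (fun x => \int[m2]_(y in D2) f (x, y)).
Proof.
move=> mf.
rewrite (_ : (fun _ => _) = fun x =>
    \int[m2]_(y in D2) f^\+ (x, y) - \int[m2]_(y in D2) f^\- (x, y)).
  apply: emeasurable_funB; apply: ge0_measurable_integral => //.
  - exact: measurable_funepos.
  - exact: measurable_funeneg.
apply/funext => x; rewrite integralE; congr (_ - _); apply: eq_integral => y _.
  by rewrite !funeposE.
by rewrite !funenegE.
Qed.

Variables (m1 : {sigma_finite_measure set T1 -> \bar R}) (D1 : set T1).
Hypothesis (mD1 : measurable D1).
Variable f : T1 * T2 -> \bar R.
Hypotheses (mf : measurable_fun setT f) (f0 : forall z, 0 <= f z).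

Let g := f \_ (D1 `*` D2).

Let mg : measurable_fun setT g.
Proof.
apply/(measurable_restrictT _ _).1; first exact: measurableX.
exact: measurable_funTS.
Qed.

Let g0 z : 0 <= g z. Proof. by rewrite /g patchE; case: ifP. Qed.

Lemma tonelli12 : \int[m1 \x m2]_(z in D1 `*` D2) f z =
  \int[m1]_(x in D1) \int[m2]_(y in D2) f (x, y).
Proof.
rewrite integral_mkcond (fubini_tonelli1 g)// [RHS]integral_mkcond.
apply: eq_integral => x _; rewrite /fubini_F patchE.
have [xD|xD] := boolP (x \in D1).
  rewrite [RHS]integral_mkcond; apply: eq_integral => y _.
  by rewrite /g !patchE in_setX xD.
by apply: integral0_eq => y _; rewrite /g patchE in_setX (negbTE xD).
Qed.

Lemma tonelli21 : \int[m1 \x m2]_(z in D1 `*` D2) f z =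
  \int[m2]_(y in D2) \int[m1]_(x in D1) f (x, y).
Proof.
rewrite integral_mkcond (fubini_tonelli2 g)// [RHS]integral_mkcond.
apply: eq_integral => x _; rewrite /fubini_G patchE.
have [xD|xD] := boolP (x \in D2).
  rewrite [RHS]integral_mkcond; apply: eq_integral => y _.
  by rewrite /g !patchE in_setX xD andbT.
by apply: integral0_eq => y _; rewrite /g patchE in_setX (negbTE xD) andbF.
Qed.

End product_integrals.

(** Compared with [cbm] the bound is dropped: a given eigenfunction is only square integrable. *)
Definition cmeas d (T : measurableType d) (R : realType) (f : T -> R[i]) :=
  measurable_fun setT (fun x => Re (f x)) /\ measurable_fun setT (fun x => Im (f x)).

Section null_integrals.
Context d (T : measurableType d) (R : realType).
Variables (mu : {measure set T -> \bar R}) (D : set T).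
Hypothesis (mD : measurable D).

Lemma ge0_integral_eq0 (f : T -> \bar R) : measurable_fun setT f ->
  (forall x, 0 <= f x)%E ->
  ((\int[mu]_(x in D) f x)%E = 0%E <-> {ae mu, forall x, D x -> f x = 0%E}).
Proof.
move=> mf f0; have := ae_eq_integral_abs mu mD (measurable_funTS mf).
by under eq_integral do rewrite gee0_abs//.
Qed.

Lemma integral_gt0 (f : T -> \bar R) : measurable_fun setT f ->
  (forall x, 0 <= f x)%E -> (forall x, D x -> 0 < f x)%E -> (0 < mu D)%E ->
  (0 < \int[mu]_(x in D) f x)%E.
Proof.
move=> mf f0 fD muD; rewrite lt0e integral_ge0// andbT; apply/eqP.
move=> /(ge0_integral_eq0 mf f0)[N [mN N0 DN]].
suff : mu D = 0%E by move=> mu0; rewrite mu0 ltxx in muD.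
apply: (@subset_measure0 _ _ _ mu _ N) => // x Dx; apply: DN => /(_ Dx) fx0.
by have := fD _ Dx; rewrite fx0 ltxx.
Qed.

Lemma ae_eq_Cint (f g : T -> R[i]) :
  cmeas f -> cmeas g ->
  {ae mu, forall x, D x -> f x = g x} -> Cintegral mu D f = Cintegral mu D g.
Proof.
move=> [fR fI] [gR gI] fg; rewrite /Cintegral; congr (_ +i* _)%C.
- congr fine; apply: ae_eq_integral => //.
  + by apply/measurable_EFinP; exact: measurable_funTS.
  + by apply/measurable_EFinP; exact: measurable_funTS.
  + by apply: filterS fg => x fgx /fgx ->.
- congr fine; apply: ae_eq_integral => //.
  + by apply/measurable_EFinP; exact: measurable_funTS.
  + by apply/measurable_EFinP; exact: measurable_funTS.
  + by apply: filterS fg => x fgx /fgx ->.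
Qed.

End null_integrals.

Section sqnorm.
Context d (T : measurableType d) (R : realType).
Implicit Types f g : T -> R[i].

Lemma cbm_cmeas f : cbm f -> cmeas f.
Proof. by move=> [[? _] [? _]]. Qed.

Lemma cmeasM f g : cmeas f -> cmeas g -> cmeas (fun x => f x * g x).
Proof.
move=> [fR fI] [gR gI]; split.
- rewrite (_ : (fun _ => _) = (fun x => Re (f x) * Re (g x) - Im (f x) * Im (g x))).
    by apply: measurable_funB; exact: measurable_funM.
  by apply/funext => x /=; rewrite ReM.
- rewrite (_ : (fun _ => _) = (fun x => Re (f x) * Im (g x) + Im (f x) * Re (g x))).
    by apply: measurable_funD; exact: measurable_funM.
  by apply/funext => x /=; rewrite ImM.
Qed.

Lemma cmeas_comp d' (T' : measurableType d') (h : T' -> T) f :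
  measurable_fun setT h -> cmeas f -> cmeas (fun x => f (h x)).
Proof.
by move=> mh [fR fI]; split; [exact: measurableT_comp fR mh|exact: measurableT_comp fI mh].
Qed.

Lemma normc_sqr (z : R[i]) : normc z ^+ 2 = Re z ^+ 2 + Im z ^+ 2.
Proof. by case: z => x y /=; rewrite sqr_sqrtr// addr_ge0// sqr_ge0. Qed.

Definition sqn f x : \bar R := (normc (f x) ^+ 2)%:E.

Lemma sqn_ge0 f x : (0 <= sqn f x)%E. Proof. by rewrite lee_fin sqr_ge0. Qed.

Lemma measurable_sqn f : cmeas f -> measurable_fun setT (sqn f).
Proof.
move=> [fR fI]; apply/measurable_EFinP.
rewrite (_ : (fun _ => _) = fun x => Re (f x) ^+ 2 + Im (f x) ^+ 2).
  by apply: measurable_funD; exact: measurable_funX.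
by apply/funext => x; rewrite normc_sqr.
Qed.

Lemma sqn_eq0 f x : sqn f x = 0%E -> f x = 0.
Proof.
move=> [] /eqP; rewrite expf_eq0 /= => /eqP; exact: ComplexField.Normc.eq0_normc.
Qed.

Lemma sqn0 f x : f x = 0 -> sqn f x = 0%E.
Proof. by move=> fx; rewrite /sqn fx ComplexField.Normc.normc0 expr0n. Qed.

End sqnorm.

(** * Eigenfunctions give zeros of the determinant *)

Section eigenvalue_characterization.
Context d (T : measurableType d) (R : realType).
Variables (mu : {sigma_finite_measure set T -> \bar R}) (D : set T).
Hypotheses (mD : measurable D) (fD : (mu D < +oo)%E).
Let C := R[i].
Let Cint := Cintegral mu D.
Variable k : T -> T -> T -> C.
Hypothesis bk : cbm (fun z : T * T * T => k z.1.1 z.1.2 z.2).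
Variable M : R.
Hypothesis kM : forall x t y, normc (k x t y) <= M.
Variable lambda : C.
Hypothesis lambda0 : lambda != 0.
Let kappa := lambda^-1.
Let Phi j y := fredholm_D mu D kappa k j y.

Definition fiber_operator (f : T * T -> C) : T * T -> C :=
  fun p => Cint (fun s => k p.1 s p.2 * f (s, p.2)).

Let mDD : measurable (D `*` D). Proof. exact: measurableX. Qed.

(* A square integrable solution [phi] of [kappa K phi = phi] agrees almost
   everywhere with the bounded function [kappa K phi]. *)
Lemma fiber_eigenfunction y (phi : T -> C) : cmeas phi ->
  (\int[mu]_(x in D) sqn phi x < +oo)%E ->
  {ae mu, forall x, D x -> Cint (fun s => k x s y * phi s) = lambda * phi x} ->
  (\int[mu]_(x in D) sqn phi x != 0)%E -> Phi 0 y = 0.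
Proof.
move=> mphi phi2 phiE phin0; apply/eqP; apply: contraNT phin0 => D0.
have mk2 : cbm (fun z : T * T => k z.1 z.2 y).
  apply: (cbm_comp (h := fun z : T * T => (z.1, z.2, y)) _ bk).
  by apply: measurable_fun_pair => //; exact: measurable_fun_pair.
have mkx x : cbm (fun s => k x s y) by exact: (cbm_section1 x y bk).
have mkphi : cmeas (fun z : T * T => k z.1 z.2 y * phi z.2).
  by apply: cmeasM; [exact: cbm_cmeas|exact: cmeas_comp measurable_snd mphi].
have mkxphi x : cmeas (fun s => k x s y * phi s).
  by apply: cmeasM => //; exact: cbm_cmeas.
pose K x := Cint (fun s => k x s y * phi s).
(* Since [|phi| <= 1 + |phi|^2] and [D] has finite measure, [w] is an integrable majorant of [k phi]
   independent of [x]; it makes [K phi] bounded. *)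
pose w s := `|M| * (1 + normc (phi s) ^+ 2).
have iw : mu.-integrable D (EFin \o w).
  have i1 : mu.-integrable D (fun s => (1%:E + sqn phi s)%E).
    apply: integrableD => //; first exact: (rbm_integrable mD fD (rbm_cst T 1)).
    apply/integrableP; split; first exact: measurable_funTS (measurable_sqn mphi).
    by under eq_integral do rewrite gee0_abs ?sqn_ge0//.
  by have := integrableZl mD `|M| i1.
have kphi_w x s : normc (k x s y * phi s) <= w s.
  rewrite ComplexField.Normc.normcM /w ler_pM ?normc_ge0//.
    exact: le_trans (kM _ _ _) (ler_norm _).
  have := sqr_ge0 (normc (phi s) - 1); have := normc_ge0 (phi s); rewrite expr2; lra.
have int_le (p : T -> R) x : measurable_fun setT p ->
    (forall s, `|p s| <= normc (k x s y * phi s)) ->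
    `|\int[mu]_(s in D) p s| <= \int[mu]_(s in D) w s.
  move=> mp pk.
  have ip : mu.-integrable D (EFin \o p).
    apply: (le_integrable mD _ _ iw).
      by apply/measurable_EFinP; exact: measurable_funTS.
    move=> s _; rewrite lee_fin; apply: le_trans (pk s) _.
    exact: le_trans (kphi_w x s) (ler_norm _).
  apply: le_trans (le_normr_Rintegral mD ip) _; apply: le_Rintegral => //.
    by have := integrable_abse ip.
  by move=> s _; apply: le_trans (pk s) _.
have mint (p : T * T -> R) : measurable_fun setT p ->
    measurable_fun setT (fun x => \int[mu]_(s in D) p (x, s)).
  move=> mp; apply: measurableT_comp => //.
  apply: (emeasurable_integral mu mD (f := EFin \o p)).
  exact/measurable_EFinP.
have bK : cbm K.
  case: mkphi => mR mI; split; split.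
  - exact: mint mR.
  - exists (\int[mu]_(s in D) w s) => x.
    apply: (int_le _ x); first by case: (mkxphi x).
    by move=> s; exact: normr_Re_le.
  - exact: mint mI.
  - exists (\int[mu]_(s in D) w s) => x.
    apply: (int_le _ x); first by case: (mkxphi x).
    by move=> s; exact: normr_Im_le.
pose psi x := kappa * K x.
have bpsi : cbm psi by exact: cbmZ.
have psi_phi : {ae mu, forall x, D x -> psi x = phi x}.
  by apply: filterS phiE => x h /h; rewrite /psi /K => ->; rewrite mulKf.
(* Replacing [phi] by [psi] under the integral changes nothing, so the equation for [psi] holds at
   every [x], as [fredholm_injective] requires. *)
have psiE x : psi x = kappa * Cint (fun s => k x s y * psi s).
  congr (_ * _); apply: ae_eq_Cint => //.
    by apply: cmeasM; exact: cbm_cmeas.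
  by apply: filterS psi_phi => s h /h ->.
have psi0 := fredholm_injective mD fD bk kM bpsi psiE D0.
apply/eqP/(ge0_integral_eq0 mu mD (measurable_sqn mphi) (sqn_ge0 phi)).
by apply: filterS psi_phi => x h /h /esym; rewrite psi0 => /sqn0.
Qed.

(** By Tonelli's theorem almost every fiber is square integrable and solves its equation almost
    everywhere. If almost none of these fibers were nonzero, the eigenfunction itself would vanish
    almost everywhere. *)
Lemma eigenvalue_fredholm_zero :
  L2_eigenvalue (mu \x mu)%E (D `*` D) fiber_operator lambda ->
  exists Omega0, [/\ measurable Omega0, Omega0 `<=` D, (0 < mu Omega0)%E &
    forall y, Omega0 y -> Phi 0 y = 0].
Proof.
move=> [f [[fR fI f2] fn0 Af]].
pose g z : C := if z \in D `*` D then f z else 0.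
have gE z : (D `*` D) z -> g z = f z by move=> Dz; rewrite /g mem_set.
have mg : cmeas g.
  split.
  - rewrite (_ : (fun _ => _) = (fun z => Re (f z)) \_ (D `*` D)).
      by apply/(measurable_restrictT _ _).1.
    by apply/funext => z; rewrite /g patchE; case: ifP.
  - rewrite (_ : (fun _ => _) = (fun z => Im (f z)) \_ (D `*` D)).
      by apply/(measurable_restrictT _ _).1.
    by apply/funext => z; rewrite /g patchE; case: ifP.
have mg2 := measurable_sqn mg.
pose h y := (\int[mu]_(x in D) sqn g (x, y))%E.
have hE : (\int[mu \x mu]_(z in D `*` D) sqn g z = \int[mu]_(y in D) h y)%E.
  exact: (tonelli21 mu mD mu mD mg2 (sqn_ge0 g)).
have mh : measurable_fun setT h.
  apply: (emeasurable_integral mu mD (f := fun z : T * T => sqn g (z.2, z.1))).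
  by apply: measurableT_comp mg2 _; exact: measurable_swap.
have h0 y : (0 <= h y)%E by apply: integral_ge0 => x _; exact: sqn_ge0.
have hoo : (\int[mu]_(y in D) h y < +oo)%E.
  rewrite -hE; apply: le_lt_trans f2; rewrite le_eqVlt; apply/orP; left; apply/eqP.
  by apply: eq_integral => z; rewrite inE => /gE gz; rewrite /sqn gz.
case: Af => N [mN N0 NA].
pose e z : \bar R := (\1_N z)%:E.
have me : measurable_fun setT e by apply/measurable_EFinP; exact: measurable_indic.
have e0 z : (0 <= e z)%E by rewrite lee_fin.
(* The measure of the section at [y] of the null set [N] outside which the eigenvalue equation
   holds. *)
pose nu y := (\int[mu]_(x in D) e (x, y))%E.
have mnu : measurable_fun setT nu.
  apply: (emeasurable_integral mu mD (f := fun z : T * T => e (z.2, z.1))).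
  by apply: measurableT_comp me _; exact: measurable_swap.
have nu0 y : (0 <= nu y)%E by exact: integral_ge0.
have nu_ae : {ae mu, forall y, D y -> nu y = 0%E}.
  apply/(ge0_integral_eq0 mu mD mnu nu0).
  rewrite -(tonelli21 mu mD mu mD me e0); apply/(ge0_integral_eq0 _ mDD me e0).
  exists N; split=> // z /= /not_implyP[_]; apply: contra_notP => Nz.
  by rewrite /e indicE memNset.
have h_ae : {ae mu, forall y, D y -> h y \is a fin_num}.
  apply: integrable_ae => //; apply/integrableP; split; first exact: measurable_funTS.
  by under eq_integral do rewrite gee0_abs//.
(* Fibers that are nonzero, square integrable, and almost everywhere outside [N]. Each condition is
   put on a measurable function of [y], so that [Omega0] is measurable. *)
pose Omega0 := (D `&` [set y | h y != 0%E]) `&` (D `&` [set y | h y < +oo]%E) `&`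
  (D `&` [set y | nu y <= 0]%E).
have mO : measurable Omega0.
  apply: measurableI; first apply: measurableI.
  - by apply: emeasurable_neq => //; exact: measurable_funTS mh.
  - by apply: emeasurable_fun_infty_o => //; exact: measurable_funTS mh.
  - by apply: emeasurable_fun_infty_c => //; exact: measurable_funTS mnu.
exists Omega0; split=> //.
- by move=> y [[[]]].
- rewrite lt0e measure_ge0 andbT; apply/eqP => muO.
  apply: fn0.
  have hz : {ae mu, forall y, D y -> h y = 0%E}.
    have O_ae : {ae mu, forall y, ~ Omega0 y}.
      by exists Omega0; split=> // y /= /contrapT.
    apply: filterS3 nu_ae h_ae O_ae => y nuy hy Oy Dy.
    apply/eqP; apply: contra_notT Oy => hy0; split; [split|] => //; split=> //=.
      by have := hy Dy; rewrite ge0_fin_numE.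
    by rewrite nuy.
  have /(ge0_integral_eq0 _ mDD mg2 (sqn_ge0 g)) : (\int[mu \x mu]_(z in D `*` D) sqn g z = 0)%E.
    by rewrite hE; exact/(ge0_integral_eq0 mu mD mh h0).
  by apply: filterS => z gz Dz; rewrite -gE//; apply: sqn_eq0; exact: gz.
- move=> y [[[Dy /= hy0] [_ /= hyoo]] [_ /= nuy]].
  have mphi : cmeas (fun x => g (x, y)) by exact: cmeas_comp (pair2_measurable y) mg.
  apply: (fiber_eigenfunction mphi) => //.
  have nuy0 : nu y = 0%E by apply/eqP; rewrite eq_le nuy nu0.
  have mey : measurable_fun setT (fun x => e (x, y)).
    exact: measurableT_comp me (pair2_measurable y).
  move/(ge0_integral_eq0 mu mD mey (fun x => e0 (x, y))) : nuy0.
  apply: filterS => x ex Dx.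
  have Nxy : ~ N (x, y).
    by move=> Nxy; have := ex Dx; rewrite /e indicE mem_set// => -[] /eqP; rewrite oner_eq0.
  rewrite gE//.
  have : D `*` D `<=` [set z | fiber_operator f z = lambda * f z] `|` N.
    move=> z Dz; have [Nz|Nz] := pselect (N z); [by right|left].
    by apply: contrapT => fz; apply: Nz; apply: NA => /(_ Dz).
  move=> /(_ (x, y)) [//| <- |//]; rewrite /fiber_operator /=.
  by apply: eq_Cint => s Ds; rewrite gE.
Qed.

End eigenvalue_characterization.

(** * Zeros of the determinant give eigenfunctions *)

Section fredholm_zero.
Context d (T : measurableType d) (R : realType).
Variables (mu : {sigma_finite_measure set T -> \bar R}) (D : set T).
Hypotheses (mD : measurable D) (fD : (mu D < +oo)%E).
Let C := R[i].
Let Cint := Cintegral mu D.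
Variable k : T -> T -> T -> C.
Hypothesis bk : cbm (fun z : T * T * T => k z.1.1 z.1.2 z.2).
Variable M : R.
Hypothesis kM : forall x t y, normc (k x t y) <= M.
Variable lambda : C.
Hypothesis lambda0 : lambda != 0.
Let kappa := lambda^-1.
Let Phi j y := fredholm_D mu D kappa k j y.
Let G j x t y := fredholm_G mu D kappa k j x t y.

Let bG j : cbm (fun z : T * T * T => G j z.1.1 z.1.2 z.2).
Proof. exact: (cbm_fredholm_G mD fD kappa bk kM j). Qed.

Definition colsqn (F : T -> T -> T -> C) y t : \bar R :=
  \int[mu]_(x in D) sqn (fun x => F x t y) x.

Lemma colsqn_ge0 F y t : (0 <= colsqn F y t)%E.
Proof. by apply: integral_ge0 => x _; exact: sqn_ge0. Qed.

Lemma measurable_colsqn (F : T -> T -> T -> C) :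
  cbm (fun z : T * T * T => F z.1.1 z.1.2 z.2) ->
  measurable_fun setT (fun z : T * T => colsqn F z.1 z.2).
Proof.
move=> bF; apply: (emeasurable_integral mu mD
  (f := fun z : T * T * T => sqn (fun z : T * T * T => F z.1.1 z.1.2 z.2) (z.2, z.1.2, z.1.1))).
apply: measurableT_comp (measurable_sqn (cbm_cmeas bF)) _.
apply: measurable_fun_pair; first apply: measurable_fun_pair.
- exact: measurable_snd.
- exact: measurableT_comp measurable_snd measurable_fst.
- exact: measurableT_comp measurable_fst measurable_fst.
Qed.

Lemma Cint_colsqn0 F y t (g : T -> C) :
  cbm (fun z : T * T * T => F z.1.1 z.1.2 z.2) -> cbm g ->
  colsqn F y t = 0%E -> Cint (fun s => g s * F s t y) = 0.
Proof.
move=> bF bg; have bFs : cbm (fun s => F s t y) by exact: (cbm_section2 t y bF).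
have mF := cbm_cmeas bFs.
move/(ge0_integral_eq0 mu mD (measurable_sqn mF) (sqn_ge0 _)) => F0.
rewrite -[RHS](Cint0 mD fD); apply: ae_eq_Cint => //.
- by apply: cmeasM => //; exact: cbm_cmeas.
- by apply: filterS F0 => s Fs /Fs /sqn_eq0 /= ->; rewrite mulr0.
Qed.

(** The squared Hilbert-Schmidt norm of the kernel [G_j (., .; y)]: its vanishing is a measurable
    condition on [y] that says [G_j = 0] almost everywhere. *)
Let n j y := (\int[mu]_(t in D) colsqn (G j) y t)%E.

Let measurable_colsqn_section F y :
  cbm (fun z : T * T * T => F z.1.1 z.1.2 z.2) -> measurable_fun setT (colsqn F y).
Proof.
move=> bF; exact: measurableT_comp (measurable_colsqn bF) (pair1_measurable y).
Qed.

Let bW j y : cbm (fun t => Cint (fun s => k t s y * G j s t y)).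
Proof.
apply: (@cbm_Cint _ _ T T R mu D (fun z => k z.1 z.2 y * G j z.2 z.1 y)) => //.
apply: cbmM.
  apply: (cbm_comp (h := fun z : T * T => (z.1, z.2, y)) _ bk).
  by apply: measurable_fun_pair => //; exact: measurable_fun_pair.
apply: (cbm_comp (h := fun z : T * T => (z.2, z.1, y)) _ (bG j)).
by apply: measurable_fun_pair => //; exact: measurable_fun_pair.
Qed.

(** The trace of [K G_j] integrates [G_j] over all of [D x D], so vanishing almost everywhere is
    enough. *)
Let trace0 j y : n j y = 0%E ->
  Cint (fun t => Cint (fun s => k t s y * G j s t y)) = 0.
Proof.
move/(ge0_integral_eq0 mu mD (measurable_colsqn_section y (bG j)) (colsqn_ge0 _ _)) => n0.
rewrite -[RHS](Cint0 mD fD); apply: ae_eq_Cint => //.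
- exact: cbm_cmeas.
- apply: filterS n0 => t nt Dt; apply: Cint_colsqn0 => //; last exact: nt.
  exact: (cbm_section1 t y bk).
Qed.

(* The trace of the recurrence for [G] shows that the determinant vanishes to
   higher order in [kappa] than the minor. *)
Lemma fredholm_D_vanish y r : Phi 0 y = 0 -> (forall j, (j < r)%N -> n j y = 0%E) ->
  Phi r y = 0.
Proof.
move=> Phi0; elim: r => [//|r IH] nr.
have Pr : Phi r y = 0 by apply: IH => j jr; apply: nr; rewrite ltnW.
rewrite /Phi (fredholm_D_S mD fD kappa bk kM); apply/eqP; rewrite oppr_eq0; apply/eqP.
pose W j t := Cint (fun s => k t s y * G j s t y).
(* On the diagonal [G r] is replaced by its recurrence, whose first term drops out because
   [D_r = 0]. *)
transitivity (Cint (fun x => kappa * W r x + r%:R * W r.-1 x)).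
  apply: eq_Cint => x _; rewrite (fredholm_G_rec mD fD kappa bk kM).
  by rewrite -/(Phi r y) Pr mul0r add0r.
transitivity (kappa * Cint (W r) + r%:R * Cint (W r.-1)).
  apply: (etrans (CintD mD fD (cbmZ kappa (bW r y)) (cbmZ r%:R (bW r.-1 y)))).
  apply: (f_equal2 (fun a b : C => a + b)).
    exact: (CintZ mD fD kappa (bW r y)).
  exact: (CintZ mD fD r%:R (bW r.-1 y)).
have WE j : n j y = 0%E -> Cint (W j) = 0 by exact: trace0.
have aux (c c' u v : C) : u = 0 -> c' = 0 \/ v = 0 -> c * u + c' * v = 0.
  by move=> -> [->|->]; rewrite ?mulr0 ?mul0r addr0.
apply: aux; first exact/WE/nr.
by case: r {IH Pr} nr => [|r] nr; [left|right; exact/WE/nr].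
Qed.

(** The recurrence loses its first term by [D_r = 0] and its third because [K] ignores null sets; so
    the equation holds at every [x]. For [r = 0] the condition on [r'] is vacuous and the third term
    has coefficient [0]. *)
Lemma fredholm_G_eigen y t r : Phi r y = 0 ->
  (forall r', r = r'.+1 -> colsqn (G r') y t = 0%E) ->
  forall x, Cint (fun s => k x s y * G r s t y) = lambda * G r x t y.
Proof.
move=> Pr Gr x.
have GE : G r x t y = kappa * Cint (fun s => k x s y * G r s t y) +
    r%:R * Cint (fun s => k x s y * G r.-1 s t y).
  rewrite {1}/G (fredholm_G_rec mD fD kappa bk kM).
  by rewrite -/(Phi r y) Pr mul0r add0r.
suff z : r%:R * Cint (fun s => k x s y * G r.-1 s t y) = 0.
  by rewrite GE z addr0 /kappa mulVKf.
clear GE.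
case: r Pr Gr => [|r] Pr Gr; first by rewrite mulr0n mul0r.
rewrite [X in _ * X](@Cint_colsqn0 (G r) y t (fun s => k x s y)) ?mulr0//.
  exact: (cbm_section1 x y bk).
exact: Gr.
Qed.

Let measurable_n j : measurable_fun setT (n j).
Proof.
exact: (emeasurable_integral mu mD (measurable_colsqn (bG j))).
Qed.

Let n_ge0 j y : (0 <= n j y)%E.
Proof. by apply: integral_ge0 => t _; exact: colsqn_ge0. Qed.

Lemma fredholm_zero_order (Omega0 : set T) : measurable Omega0 ->
  (0 < mu Omega0)%E -> (forall y, Omega0 y -> Phi 0 y = 0) ->
  exists r (A : set T), [/\ measurable A, A `<=` Omega0, (0 < mu A)%E,
    (forall y, A y -> (0 < n r y)%E) &
    forall y j, A y -> (j < r)%N -> n j y = 0%E].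
Proof.
move=> mO muO O0.
pose S j := Omega0 `&` [set y | n j y != 0%E].
have mS j : measurable (S j).
  by apply: emeasurable_neq => //; exact: measurable_funTS (measurable_n j).
(* At a point outside every [S j] all the minors would vanish almost everywhere, hence all
   derivatives of the determinant would vanish. *)
have OS : Omega0 = \bigcup_j S j.
  apply/seteqP; split => [y Oy|y [j _ []//]].
  apply: contrapT => h; have [j] := exists_fredholm_D_neq0 mD fD kappa bk kM y.
  apply/negP; rewrite negbK; apply/eqP.
  apply: fredholm_D_vanish; first exact: O0.
  move=> i _; apply/eqP; apply: contra_notT h => ni; by exists i.
have mSD j : measurable (seqDU S j).
  by apply: measurableD => //; exact: bigsetU_measurable.
(* The piece [seqDU S r] consists of the [y] for which [r] is the least order; countably many null
   pieces cannot cover [Omega0]. *)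
have [r muS] : exists r, (0 < mu (seqDU S r))%E.
  apply: contrapT => h; suff muO0 : mu Omega0 = 0%E by rewrite muO0 ltxx in muO.
  have : mu.-negligible (\bigcup_j seqDU S j).
    apply: negligible_bigcup => j; exists (seqDU S j); split=> //.
    by apply/eqP; apply: contra_notT h => hj; exists j; rewrite lt0e hj measure_ge0.
  by rewrite -seqDU_bigcup_eq -OS; exact: measure_negligible.
exists r, (seqDU S r); split=> //.
- by move=> y [[]].
- by move=> y [[_ ny] _]; rewrite lt0e ny n_ge0.
- move=> y j [[Oy _] nS] jr; apply/eqP; apply: contra_notT nS => nj.
  by rewrite -bigcup_mkord; exists j.
Qed.

Lemma fredholm_zero_eigenvalue (Omega0 : set T) : measurable Omega0 ->
  Omega0 `<=` D -> (0 < mu Omega0)%E -> (forall y, Omega0 y -> Phi 0 y = 0) ->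
  L2_eigenvalue (mu \x mu)%E (D `*` D) (fiber_operator mu D k) lambda.
Proof.
move=> mO OD muO O0.
have [r [A [mA AO muA nr njr]]] := fredholm_zero_order mO muO O0.
have AD : A `<=` D by exact: subset_trans OD.
(* The preceding minor [G_(r-1)], which must vanish along the chosen column; [0] when there is
   none. *)
pose H := if r is r'.+1 then G r' else fun _ _ _ => 0.
have bH : cbm (fun z : T * T * T => H z.1.1 z.1.2 z.2).
  by rewrite /H; case: (r) => [|r']; [exact: cbm_cst|exact: bG].
have Hy y : A y -> (\int[mu]_(t in D) colsqn H y t)%E = 0%E.
  move=> Ay; rewrite /H; case: (r) (njr y) => [|r'] nj; last exact: nj.
  apply: integral0_eq => t _; apply: integral0_eq => x _; exact: sqn0.
pose tot F t := (\int[mu]_(y in A) colsqn F y t)%E.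
have totE F : cbm (fun z : T * T * T => F z.1.1 z.1.2 z.2) ->
    (\int[mu]_(t in D) tot F t = \int[mu]_(y in A) \int[mu]_(t in D) colsqn F y t)%E.
  move=> bF.
  have h0 (z : T * T) : (0 <= colsqn F z.1 z.2)%E by exact: colsqn_ge0.
  by rewrite -(tonelli21 mu mD mu mA (measurable_colsqn bF) h0)
    (tonelli12 mu mD mu mA (measurable_colsqn bF) h0).
have mtot F : cbm (fun z : T * T * T => F z.1.1 z.1.2 z.2) -> measurable_fun setT (tot F).
  move=> bF; apply: (emeasurable_integral mu mA (f := fun z : T * T => colsqn F z.2 z.1)).
  have ms : measurable_fun setT (fun z : T * T => (z.2, z.1)) by exact: measurable_swap.
  exact: (measurableT_comp (measurable_colsqn bF) ms).
have tot0 F t : (0 <= tot F t)%E by apply: integral_ge0 => y _; exact: colsqn_ge0.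
(* Integrated over [t], [tot H] gives [0] and [tot (G r)] a positive value. So [tot H] vanishes for
   almost every [t] while [tot (G r)] does not, and some [t] meets both demands. *)
have [t [Dt Ht Gt]] : exists t, [/\ D t, tot H t = 0%E & tot (G r) t != 0%E].
  apply: contrapT => h.
  have : (0 < \int[mu]_(t in D) tot (G r) t)%E.
    rewrite totE//; apply: integral_gt0 => //; [exact: measurable_n|exact: n_ge0].
  have -> : (\int[mu]_(t in D) tot (G r) t = 0)%E; last by rewrite ltxx.
  apply/(ge0_integral_eq0 mu mD (mtot _ (bG r)) (tot0 _)).
  have : (\int[mu]_(t in D) tot H t = 0)%E by rewrite totE//; exact: integral0_eq.
  move/(ge0_integral_eq0 mu mD (mtot _ bH) (tot0 _)); apply: filterS => t Ht Dt.
  by apply/eqP; apply: contra_notT h => Gt; exists t; split=> //; exact: Ht.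
(* The operator acts in [x] only, so cutting off in [y] preserves the equation: on fibers outside
   [A] both sides are [0]. *)
pose f (z : T * T) := G r z.1 t z.2 * (\1_A z.2)%:C%C.
have bGt : cbm (fun z : T * T => G r z.1 t z.2).
  apply: (cbm_comp (h := fun z : T * T => (z.1, t, z.2)) _ (bG r)).
  by apply: measurable_fun_pair => //; exact: measurable_fun_pair.
have bf : cbm f.
  apply: cbmM => //.
  exact: cbm_comp measurable_snd (cbm_indic R mA).
have [mfR mfI] := cbm_cmeas bf.
have mDD : measurable (D `*` D) by exact: measurableX.
have fDD : ((mu \x mu) (D `*` D) < +oo)%E.
  by rewrite product_measure1E// lte_mul_pinfty// ge0_fin_numE.
exists f; split.
- split; [exact: measurable_funTS mfR|exact: measurable_funTS mfI|].
  case: bf => bR bI.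
  have b2 : bounded_measurable (fun z => Re (f z) * Re (f z) + Im (f z) * Im (f z)).
    by apply: rbmD; exact: rbmM.
  have := integrable_lty mDD (rbm_integrable mDD fDD b2).
  by under eq_integral do rewrite /= -!expr2 -normc_sqr.
- move=> f0; move/eqP: Gt; apply.
  have mGt := measurable_sqn (cbm_cmeas bGt).
  have -> : tot (G r) t = (\int[mu \x mu]_(z in D `*` A) sqn (fun z : T * T => G r z.1 t z.2) z)%E.
    by rewrite (tonelli21 mu mA mu mD mGt (sqn_ge0 _)).
  apply/(ge0_integral_eq0 _ (measurableX mD mA) mGt (sqn_ge0 _)).
  apply: filterS f0 => -[x y] /= fxy [/= Dx Ay]; apply: sqn0 => /=.
  have /fxy : (D `*` D) (x, y) by split=> //; exact: AD.
  by rewrite /f /= indicE mem_set//= mulr1.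
- have mHt : measurable_fun setT (fun y => colsqn H y t).
    exact: measurableT_comp (measurable_colsqn bH) (pair2_measurable t).
  case: ((ge0_integral_eq0 mu mA mHt (fun y => colsqn_ge0 H y t)).1 Ht) => N [mN N0 NA].
  (* The equation can fail only for [y] in the null set [N] where the column of [H] does not vanish;
     for every other [y] it holds at all [x]. *)
  exists (setT `*` N); split; first exact: measurableX.
    by rewrite [LHS]product_measure1E// N0 mule0.
  move=> [x y] /= /not_implyP[[/= Dx Dy] fxy]; split=> //=.
  apply: contra_notP fxy => Ny; rewrite /fiber_operator /f /=.
  have [Ay|Ay] := pselect (A y); last first.
    rewrite indicE memNset//= rmorph0 [in RHS]mulr0 [in RHS]mulr0.
    rewrite -[RHS](Cint0 mD fD).
    by apply: eq_Cint => s _; rewrite mulr0 mulr0.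
  rewrite indicE mem_set//=.
  rewrite rmorph1.
  rewrite [in RHS]mulr1.
  have Hyt : colsqn H y t = 0%E.
    by apply: contrapT => h; apply: Ny; apply: NA => /(_ Ay).
  rewrite -(@fredholm_G_eigen y t r); last 2 first.
  - by apply: fredholm_D_vanish; [exact/O0/AO|move=> j jr; exact: njr].
  - by move=> r' rE; move: Hyt; rewrite /H rE.
  by apply: eq_Cint => s _; rewrite mulr1.
Qed.

End fredholm_zero.

(** * Continuous kernels on the cube *)

Lemma measurable_fun_countable d (S : measurableType d) (R : realType)
    (J : countType) (c : S -> J) (h : J -> R) :
  (forall j, measurable (c @^-1` [set j])) -> measurable_fun setT (fun s => h (c s)).
Proof.
move=> mc _ Y mY; rewrite setTI.
rewrite (_ : _ @^-1` _ =
    \bigcup_j (if `[< Y (h j) >] then c @^-1` [set j] else set0)).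
  apply: countable_bigcupT_measurable; first exact: countableP.
  by move=> j; case: ifP.
apply/seteqP; split => [s Ys|s [j _]].
  by exists (c s) => //; case: asboolP.
by case: asboolP => // Yj /= ->.
Qed.

Section grid.
Variables (R : realType) (nu : nat) (a b : R).
Local Notation T := 'rV[R]_nu.
Local Notation D := (cube nu a b).

(** Coordinates are rounded down, starting from the corner [a], so that the grid point of a point of
    the cube is again in the cube. The mesh [1 / N.+1] is defined for every [N]. *)
Definition grid_index N (x : T) : {ffun 'I_nu -> int} :=
  [ffun i => Num.floor ((x ord0 i - a) * N.+1%:R)].

Definition grid_point N (c : {ffun 'I_nu -> int}) : T :=
  \row_i (a + (c i)%:~R / N.+1%:R).

Lemma measurable_grid_index N c : measurable (grid_index N @^-1` [set c]).
Proof.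
rewrite (_ : _ @^-1` _ = \bigcap_(i in [set: 'I_nu])
    [set x : T | (c i)%:~R <= (x ord0 i - a) * N.+1%:R < (c i + 1)%:~R]).
  apply: fin_bigcap_measurable; first exact: finite_finset.
  move=> i _.
  have mx : measurable_fun setT (fun x : T => (x ord0 i - a) * N.+1%:R).
    apply: measurable_funM => //; apply: measurable_funB => //.
    exact: measurable_coord.
  have := mx measurableT `[(c i)%:~R, (c i + 1)%:~R[%classic (measurable_itv _).
  by rewrite setTI.
apply/seteqP; split => [x /= <- i _|x h] /=.
  by rewrite ffunE; exact: floor_itv.
by apply/ffunP => i; rewrite ffunE; apply: floor_def; exact: h.
Qed.

Lemma grid_point_itv N x i : D x ->
  a <= grid_point N (grid_index N x) ord0 i <= x ord0 i /\
  x ord0 i - grid_point N (grid_index N x) ord0 i < N.+1%:R^-1.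
Proof.
move=> Dx; have /andP[ax xb] := Dx i.
rewrite mxE ffunE; set y := (x ord0 i - a) * N.+1%:R.
have y0 : 0 <= y by rewrite mulr_ge0// subr_ge0.
have N0 : 0 < N.+1%:R^-1 :> R by rewrite invr_gt0.
have xE : x ord0 i = a + y / N.+1%:R by rewrite mulfK// subrKC.
have /andP[f1 f2] := floor_itv y.
split; last first.
  rewrite xE opprD addrACA subrr add0r -mulrBl -[ltRHS]mul1r ltr_pM2r//.
  by rewrite intrD in f2; lra.
rewrite lerDl divr_ge0//=; last by rewrite ler0z floor_ge0.
by rewrite xE lerD2l ler_pM2r.
Qed.

Lemma grid_point_cube N x : D x -> D (grid_point N (grid_index N x)).
Proof.
move=> Dx i; have [/andP[h1 h2] _] := grid_point_itv N i Dx.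
by rewrite h1 (le_trans h2)//; case/andP: (Dx i).
Qed.

Lemma cvg_grid_point x : D x ->
  (fun N => grid_point N (grid_index N x)) @ \oo --> x.
Proof.
move=> Dx; apply/cvg_ballP => e e0; near=> N; split=> [//|i j /=].
rewrite (ord1 i) /ball/= ger0_norm.
  have [_ h] := grid_point_itv N j Dx; apply: (lt_trans h).
  rewrite invf_plt ?posrE//; apply: lt_le_trans (_ : N%:R <= _).
    near: N; exact: nbhs_infty_gtr.
  by rewrite ler_nat.
by have [/andP[_ h] _] := grid_point_itv N j Dx; rewrite subr_ge0.
Unshelve. all: by end_near.
Qed.

Lemma measurable_cube : measurable D.
Proof.
rewrite (_ : D = \bigcap_(i in [set: 'I_nu]) [set x : T | a <= x ord0 i <= b]).
  apply: fin_bigcap_measurable; first exact: finite_finset.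
  move=> i _.
  have := @measurable_coord R nu i measurableT `[a, b]%classic (measurable_itv _).
  by rewrite setTI.
by apply/seteqP; split => x h i; [move=> _|]; exact: h.
Qed.

Lemma lebesgue_cube_lty : (lebesgue_rV nu D < +oo)%E.
Proof.
have -> : D = [set v | forall i, `[a, b]%classic (v ord0 i)].
  by apply/seteqP; split => x h i; have := h i; rewrite /= in_itv.
rewrite (@lebesgue_rV_box R nu (fun=> `[a, b]%classic))//.
suff : (\prod_(i < nu) lebesgue_measure `[a, b]%classic)%E \is a fin_num.
  by rewrite fin_numElt => /andP[].
elim/big_ind: _ => //; first by move=> x y; exact: fin_numM.
move=> i _; rewrite lebesgue_measure_itv/=; by case: ifP.
Qed.

Lemma compact_cube : compact D.
Proof.
rewrite (_ : D = [set v | forall i, `[a, b]%classic (v ord0 i)]).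
  by apply: (@rV_compact R nu (fun=> `[a, b]%classic)) => i; exact: segment_compact.
by apply/seteqP; split => x h i; have := h i; rewrite /= in_itv.
Qed.

Local Notation D3 := (D `*` D `*` D).

(* Rounding down to a grid replaces [f] by functions of countably valued
   measurable maps, which are measurable whatever [f] is. *)
Lemma measurable_within_cube3 (f : T * T * T -> R) :
  {within D3, continuous f} -> measurable_fun setT (f \_ D3).
Proof.
move=> /subspace_continuousP cf.
have mD3 : measurable D3.
  by do 2 (apply: measurableX; last exact: measurable_cube); exact: measurable_cube.
pose c N (z : T * T * T) := (grid_index N z.1.1, grid_index N z.1.2, grid_index N z.2).
pose p N (j : {ffun 'I_nu -> int} * {ffun 'I_nu -> int} * {ffun 'I_nu -> int}) :=
  (grid_point N j.1.1, grid_point N j.1.2, grid_point N j.2).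
pose g N := (fun z => f (p N (c N z))) \_ D3.
apply: (@measurable_fun_cvg _ _ _ _ g) => //.
  move=> N; apply/(measurable_restrictT _ _).1 => //; apply: measurable_funTS.
  apply: (@measurable_fun_countable _ _ _ _ (c N) (f \o p N)) => -[[j1 j2] j3].
  rewrite (_ : _ @^-1` _ = (grid_index N @^-1` [set j1]) `*`
    (grid_index N @^-1` [set j2]) `*` (grid_index N @^-1` [set j3])).
    by do 2 (apply: measurableX; last exact: measurable_grid_index); exact: measurable_grid_index.
  by apply/seteqP; split => -[[x y] z] /=; rewrite /c /=; [move=> [-> -> ->]|move=> [[-> ->] ->]].
move=> z _; rewrite patchE; have [|zD] := boolP (z \in D3); last first.
  apply: cvg_near_cst; near=> N; by rewrite /g patchE (negbTE zD).
rewrite inE => Dz; have [[Dx Dy] Dw] := Dz.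
rewrite (_ : g ^~ z = fun N => f (p N (c N z))); last first.
  by apply/funext => N; rewrite /g patchE mem_set.
have zE : z = (z.1.1, z.1.2, z.2) by case: (z) => -[].
have pz : (fun N => p N (c N z)) @ \oo --> z.
  rewrite [X in _ --> X]zE.
  have gx := cvg_grid_point Dx; have gy := cvg_grid_point Dy; have gw := cvg_grid_point Dw.
  exact: (cvg_pair (cvg_pair gx gy) gw).
(* The rounded points remain in [D3], so continuity relative to [D3] applies to them. *)
have pw : (fun N => p N (c N z)) @ \oo --> within D3 (nbhs z).
  move=> A /pz pA; apply: (@filterS _ \oo _ _ _ _ pA) => N; apply.
  split; last exact: (grid_point_cube N Dw).
  by split; [exact: (grid_point_cube N Dx)|exact: (grid_point_cube N Dy)].
exact: cvg_comp pw (cf z Dz).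
Unshelve. all: by end_near.
Qed.

Lemma bounded_within_cube3 (f : T * T * T -> R) :
  {within D3, continuous f} -> exists M, forall z, D3 z -> `|f z| <= M.
Proof.
move=> cf.
have cD3 : compact D3.
  by do 2 (apply: compact_setX; last exact: compact_cube); exact: compact_cube.
have [M [_ hM]] := compact_bounded (continuous_compact cf cD3).
by exists (M + 1) => z Dz; apply: (hM (M + 1)); [rewrite ltrDl|exists z].
Qed.

Lemma rbm_within_cube3 (f : T * T * T -> R) :
  {within D3, continuous f} -> bounded_measurable (f \_ D3).
Proof.
move=> cf; split; first exact: measurable_within_cube3.
have [M hM] := bounded_within_cube3 cf.
exists `|M| => z; rewrite patchE; case: ifPn => [|_]; last by rewrite normr0.
by rewrite inE => /hM h; exact: le_trans h (ler_norm _).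
Qed.

End grid.

(** * Comparison with limits in the complex plane, and the equivalence *)

Section complex_topology.
Variable R : realType.
Local Notation C := (R[i]^o).

Lemma continuous_lipschitz_complex (g : C -> R) :
  (forall z w, `|g z - g w| <= normc (z - w)) -> continuous g.
Proof.
move=> glip z; apply/(@cvgrPdist_lt R R C (nbhs (z : C)) (nbhs_filter (z : C))) => e e0.
have e0' : 0 < (e%:C)%C :> R[i] by rewrite ltcR.
have := @nbhsx_ballx _ C z (e%:C)%C e0'.
apply: filterS => w; rewrite -ball_normE /= norm_normc ltcR; exact: le_lt_trans.
Qed.

Lemma gsum_cvg (u : nat -> R[i]) z : gsum u z ->
  series (u : nat -> C) @ \oo --> (z : C).
Proof.
move=> [K hK]; apply/cvgrPdist_lt => e; rewrite ltcE /= => /andP[/eqP e1 e0].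
have [N hN] := geometric_lt K e0.
have K0 : 0 <= K by have := le_trans (normc_ge0 _) (hK 0); rewrite expr0 divr1.
near=> n.
rewrite norm_normc ltcE /= e1 eqxx /= /series/= big_mkord.
apply: le_lt_trans (hK n) _; apply: le_lt_trans hN.
rewrite ler_pdivrMr ?exprn_gt0// mulrAC ler_pdivlMr ?exprn_gt0//.
apply: ler_wpM2l => //; rewrite ler_eXn2l ?ltr1n//; near: n; exact: nbhs_infty_ge.
Unshelve. all: by end_near.
Qed.

(** [fredholm_det] writes the term of index [0] separately as [1] and takes the limit of the series
    from index [1] on. *)
Lemma gsum_shift (u : nat -> R[i]) z : gsum u z ->
  gsum (fun n => u n.+1) (z - u 0).
Proof.
move=> [K hK]; exists (K / 2) => N; have := hK N.+1.
by rewrite big_ord_recl opprD addrA exprS invfM mulrA.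
Qed.

End complex_topology.

Theorem theorem1 (R : realType) (nu : nat) (a b : R)
    (k : 'rV[R]_nu -> 'rV[R]_nu -> 'rV[R]_nu -> R[i]) (lambda : R[i])
    (nu_ge1 : (1 <= nu)%N) (ltab : a < b)
    (k_cont : {within cube nu a b `*` cube nu a b `*` cube nu a b,
       continuous (fun p : 'rV[R]_nu * 'rV[R]_nu * 'rV[R]_nu =>
         k p.1.1 p.1.2 p.2 : R[i]^o)})
    (lambda_neq0 : lambda != 0) :
  L2_eigenvalue (lebesgue_rV nu \x lebesgue_rV nu)%E
    (cube nu a b `*` cube nu a b) (partial_integral a b k) lambda <->
  characteristic_numbers a b k lambda^-1.
Proof.
set D := cube nu a b; set mu := lebesgue_rV nu.
have mD : measurable D by exact: measurable_cube.
have fD : (mu D < +oo)%E by exact: lebesgue_cube_lty.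
pose D3 := D `*` D `*` D.
(* Nothing is known about [k] outside the cube. Its extension by [0] is bounded and measurable
   everywhere, and has the same determinants and the same operator on the cube. *)
pose kt x s y : R[i] := if (x, s, y) \in D3 then k x s y else 0.
have ktE x s y : D x -> D s -> D y -> kt x s y = k x s y.
  by move=> Dx Ds Dy; rewrite /kt mem_set.
have bkt : cbm (fun z : 'rV[R]_nu * 'rV[R]_nu * 'rV[R]_nu => kt z.1.1 z.1.2 z.2).
  have cg (g : R[i]^o -> R) : (forall z w, `|g z - g w| <= normc (z - w)) ->
      g 0 = 0 -> bounded_measurable
        (fun z : 'rV[R]_nu * 'rV[R]_nu * 'rV[R]_nu => g (kt z.1.1 z.1.2 z.2)).
    (* For [g] the real or imaginary part, [g 0 = 0] makes [g] of the extended kernel the extension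
       by [0] of a function continuous on [D3]. *)
    move=> glip g0.
    have cgk : {within D3, continuous (fun p => g (k p.1.1 p.1.2 p.2))}.
      move=> p; apply: continuous_comp (k_cont p) _.
      exact: continuous_lipschitz_complex.
    have := rbm_within_cube3 cgk; congr bounded_measurable.
    apply/funext => -[[x s] y] /=; rewrite patchE /kt /=; case: ifP => // _.
  split; apply: cg => // z w.
  - by rewrite -ReN -ReD; exact: normr_Re_le.
  - by rewrite -ImN -ImD; exact: normr_Im_le.
have [M ktM] : exists M, forall x s y, normc (kt x s y) <= M.
  by have /cbmP[_ _ [M hM]] := bkt; exists M => x s y; exact: (hM (x, s, y)).
have DE y : D y -> D1 a b k y lambda^-1 = fredholm_D mu D lambda^-1 kt 0 y.
  move=> Dy.
  pose u n : R[i] := (- lambda^-1) ^+ n / n`!%:R * fredholm_coef mu D kt n y.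
  have us : gsum u (fredholm_D mu D lambda^-1 kt 0 y).
    exact: (gsum_fredholm_D0 mD fD _ bkt ktM).
  have := gsum_cvg (gsum_shift us).
  have u0 : u 0 = 1 by rewrite /u fredholm_coef0 expr0 fact0 divr1 mulr1.
  rewrite u0 => cu.
  rewrite /D1 /fredholm_det.
  rewrite (_ : (fun n => _) = (fun n => u n.+1)).
    by rewrite (cvg_lim (@norm_hausdorff _ _) cu) subrKC.
  apply/funext => n; rewrite /u; congr (_ * _).
  have bm : tbm (fun g : 'I_n.+1 -> 'rV[R]_nu => minor (fun x t => kt x t y) g g).
    exact: tbm_minor.
  apply: etrans (Cintegral_power_measure mD fD bm).
  apply: eq_Cint => xi Dxi; congr determinant; apply/matrixP => i j.
  by rewrite !mxE ktE//; exact: Dxi.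
have opE f p : (D `*` D) p -> partial_integral a b k f p = fiber_operator mu D kt f p.
  by move=> [Dx Dy]; apply: eq_Cint => s Ds; rewrite ktE.
have eigE : L2_eigenvalue (mu \x mu)%E (D `*` D) (partial_integral a b k) lambda <->
    L2_eigenvalue (mu \x mu)%E (D `*` D) (fiber_operator mu D kt) lambda.
  split=> -[f [f2 f0 Af]]; exists f; split=> //; apply: filterS Af => p fp Dp.
  - by rewrite -opE//; exact: fp.
  - by rewrite opE//; exact: fp.
rewrite eigE; split.
- move=> /(eigenvalue_fredholm_zero mD fD bkt ktM lambda_neq0) [A [mA AD muA A0]].
  by exists A; split=> // y Ay; rewrite DE; [exact: A0|exact: AD].
- move=> [A [mA AD muA A0]].
  apply: (fredholm_zero_eigenvalue mD fD bkt ktM lambda_neq0 mA AD muA) => y Ay.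
  by rewrite -DE; [exact: A0|exact: AD].
Qed.
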